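(* Consider the process $X$ described in the context and suppose that (A1), (A2), (A3) hold. Suppose that there exist $n\ge1$ and $\mathbf i=(i_0,\dots,i_n)\in\{1,\dots,N\}^{n+1}$ such that $$\inf_{x_0\in\mathbb R^N}\det\big(\sigma\sigma^T(x_0,\mathbf 0,\mathbf i)\big)>0.$$ Then the following Doeblin type lower bound holds: for every $z_0\in\mathbb R^N$ there exist $z_n\in\mathbb R^N$, $\delta_1,\delta_2>0$, $\beta\in\,]0,1[$ and a $C^\infty$ probability density $\nu$ on $\mathbb R^N$ with compact support contained in $B_{\delta_2}(z_n)$ such that, with $C=B_{\delta_1}(z_0)$, $$K^{n+1}(x,dy)\ge\beta\,1_C(x)\,\nu(y)\,dy .$$
   Context: Fix $N\ge 1$ and write $\mathbb R_+=[0,\infty)$. Let $b:\mathbb R^N\to\mathbb R^N$, $a_i:\mathbb R^N\to\mathbb R^N$ and $f_i:\mathbb R^N\to\mathbb R_+$, $1\le i\le N$, with $b$ and all $a_i$ continuously differentiable. Let $N^i(ds,dz)$, $1\le i\le N$, be independent Poisson random measures on $\mathbb R_+\times\mathbb R_+$ with intensity $ds\,dz$. The process $X_t\in\mathbb R^N$ solves $$X_t=X_0+\int_0^t b(X_s)\,ds+\sum_{i=1}^N\int_0^t\int_0^\infty a_i(X_{s-})1_{\{z\le f_i(X_{s-})\}}N^i(ds,dz),$$ and it is assumed throughout that this equation has a unique non-exploding solution. Notation: $\gamma_t(x)$ is the flow, $\gamma_t(x)=x+\int_0^t b(\gamma_u(x))du$; $\Delta_i(x)=x+a_i(x)$; $\bar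 f=\sum_{i=1}^N f_i$; $e(x,t)=\exp(-\int_0^t\bar f(\gamma_s(x))ds)$. (A1) The $a_i$ are measurable; the $f_i$ are Lipschitz continuous with $f_i(x)>0$ for all $x$ and $i$; $b$ is Lipschitz continuous and of linear growth. (A2) For all $x\in\mathbb R^N$, $\int_0^\infty\bar f(\gamma_s(x))ds=\infty$. (A3) $X$ is recurrent in the sense of Harris with (unique) invariant probability measure $m$: for every Borel set $O$ with $m(O)>0$, $P_x$-almost surely $\limsup_{t\to\infty}1_O(X_t)=1$ for every $x\in\mathbb R^N$. Moreover $\int f_i\,dm<\infty$ for all $i$. $K$ is the transition kernel of the jump chain (the chain of positions of $X$ just before its successive jumps), i.e. for bounded measurable $g$, $$Kg(x)=\sum_{i=1}^N\frac{f_i(x)}{\bar f(x)}\int_0^\infty e(\Delta_i(x),t)\,\bar f(\gamma_t(\Delta_i(x)))\,g(\gamma_t(\Delta_i(x)))\,dt,$$ and $K^{n+1}$ is its $(n+1)$-fold iteration. $B_\delta(z)$ is the open ball of radius $\delta$ around $z$. Derivation matrix: for $x_0\in\mathbb R^N$ and $\mathbf t=(t_1,\dots,t_{n+1})\in\mathbb R_+^{n+1}$ put $x_{k+1}=\Delta_{i_{k+1}}(\gamma_{t_{k+1}}(x_k))$, $0\le k<n$. $\sigma(x_0,\mathbf t,\mathbf i)$ is the $N\times(n+1)$ Jacobian matrix of $\mathbf t\mapsto\gamma_{t_{n+1}}(x_n)$, and $\mathbf 0$ means $t_1=\dots=t_{n+1}=0$. Explicitly, with $A^i(x)=\partial\Delta_i(x)/\partial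 x$ (Jacobian matrix) and $\bar x_0=x_0$, $\bar x_k=\Delta_{i_k}(\bar x_{k-1})$, the columns of $\sigma(x_0,\mathbf 0,\mathbf i)$ are $V_{n+1},\dots,V_1$, where $V_1=b(\bar x_n)$, $V_2=A^{i_n}(\bar x_{n-1})b(\bar x_{n-1})$, $V_3=A^{i_n}(\bar x_{n-1})A^{i_{n-1}}(\bar x_{n-2})b(\bar x_{n-2})$, ..., $V_{n+1}=A^{i_n}(\bar x_{n-1})\cdots A^{i_1}(\bar x_0)b(\bar x_0)$. *)

(* Defs.v *)
From HB Require Import structures.
From mathcomp Require Import all_boot all_order all_algebra.
From mathcomp Require Import all_classical all_reals all_analysis.
From mathcomp Require Import measurable_realfun.
Set Implicit Arguments.
Unset Strict Implicit.
Unset Printing Implicit Defensive.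
Import Order.TTheory GRing.Theory Num.Theory numFieldNormedType.Exports.
Local Open Scope classical_set_scope.
Local Open Scope ring_scope.

Section borel_matrix.
Context {R : realType} {m n : nat}.
Let G : set (set 'M[R]_(m, n)) := open.
HB.instance Definition _ := @isMeasurable.Build (sigma_display G) 'M[R]_(m, n)
  <<s G >> (@sigma_algebra0 _ setT G) (@sigma_algebraC _ G)
  (@sigma_algebra_bigcup _ setT G).
End borel_matrix.

Lemma mx_open_measurable (R : realType) m n (U : set 'M[R]_(m, n)) :
  open U -> measurable U.
Proof. by move=> oU; exact: sub_sigma_algebra. Qed.

Lemma mx_measurable_coord (R : realType) m n (i : 'I_m) (j : 'I_n) :
  measurable_fun [set: 'M[R]_(m, n)] (fun x : 'M[R]_(m, n) => x i j).
Proof.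
apply: (measurability _ (RGenOpens.measurableE R)) => _ [_ [a [b ->] <-]].
rewrite setTI; apply: mx_open_measurable.
apply: open_comp; last exact: interval_open.
by move=> x _; exact: coord_continuous.
Qed.

Lemma mx_measurable_funP d (T : measurableType d) (R : realType) m n
    (f : T -> 'M[R]_(m, n)) :
  (forall i j, measurable_fun setT (fun x => f x i j)) -> measurable_fun setT f.
Proof.
move=> mf; apply: (measurability (@open 'M[R]_(m, n))) => // _ [U oU <-].
rewrite setTI.
pose B (q : 'M[rat]_(m, n) * nat) : set 'M[R]_(m, n) :=
  [set x | forall i j, `|ratr (q.1 i j) - x i j| < q.2.+1%:R^-1].
have -> : f @^-1` U = \bigcup_q [set x | B q `<=` U /\ B q (f x)].
  apply/seteqP; split=> [x /= Ufx|x [q _ /= [BU /BU]//]].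
  have /nbhs_ballP[e /= e0 eU] : nbhs (f x) U by exact: open_nbhs_nbhs.
  have [k ke] : exists k : nat, k.+1%:R^-1 < e / 2.
    have e20 : 0 < e / 2 by rewrite divr_gt0.
    exists (Num.truncn (e / 2)^-1).
    by rewrite -[ltRHS]invrK ltf_pV2 ?posrE ?invr_gt0// truncnS_gt.
  have k0 : (0 : R) < k.+1%:R^-1 by rewrite invr_gt0.
  have qx i j : exists q : rat, `|ratr q - f x i j| < k.+1%:R^-1.
    have /rat_in_itvoo[q] : f x i j < f x i j + k.+1%:R^-1 by rewrite ltrDl.
    rewrite in_itv /= => /andP[q1 q2]; exists q.
    by rewrite ger0_norm ?subr_ge0 1?ltW// ltrBlDl.
  have [Q HQ] : {Q : 'M[rat]_(m, n) |
      forall i j, `|ratr (Q i j) - f x i j| < k.+1%:R^-1}.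
    exists (\matrix_(i, j) projT1 (cid (qx i j))) => i j.
    by rewrite mxE; case: cid.
  exists (Q, k) => //; split=> // y By; apply: eU; split=> // i j.
  rewrite -ball_normE/= (le_lt_trans (ler_distD (ratr (Q i j)) _ _))//.
  by rewrite (splitr e) ltrD ?(lt_trans _ ke)// distrC HQ.
apply: countable_bigcupT_measurable => // q.
have [BU|BU] := pselect (B q `<=` U); last first.
  by rewrite [X in measurable X](_ : _ = set0)// -subset0 => x [].
rewrite [X in measurable X](_ : _ = \bigcap_(ij in [set: 'I_m * 'I_n])
    (fun x => f x ij.1 ij.2) @^-1` ball (ratr (q.1 ij.1 ij.2) : R) q.2.+1%:R^-1).
  apply: fin_bigcap_measurable => // -[i j] _ /=.
  rewrite -[X in measurable X]setTI; apply: mf => //.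
  exact: measurable_ball.
apply/seteqP; split=> x /= => [[_ Bx] [i j] _ /=|Bx].
  by rewrite -ball_normE; exact: Bx.
by split=> // i j; have := Bx (i, j) I; rewrite -ball_normE.
Qed.

Definition rV_cons (R : realType) n (p : R * 'rV[R]_n) : 'rV[R]_n.+1 :=
  row_mx p.1%:M p.2.

Lemma rV_cons0 (R : realType) n (p : R * 'rV[R]_n) : rV_cons p 0 0 = p.1.
Proof. by rewrite /rV_cons mxE; case: splitP => // k _; rewrite ord1 mxE. Qed.

Lemma rV_consS (R : realType) n (p : R * 'rV[R]_n) j :
  rV_cons p 0 (lift ord0 j) = p.2 0 j.
Proof.
rewrite /rV_cons mxE; case: splitP => k /=; first by rewrite ord1.
by rewrite /bump /= !add1n => -[/val_inj ->].
Qed.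

Lemma measurable_rV_cons (R : realType) n :
  measurable_fun [set: R * 'rV[R]_n] (@rV_cons R n).
Proof.
apply: mx_measurable_funP => i j; rewrite (ord1 i).
case: (unliftP ord0 j) => [k ->|->].
- rewrite (_ : (fun _ => _) = (fun x : 'rV[R]_n => x 0 k) \o snd); last first.
    by apply/funext => p /=; exact: rV_consS.
  exact: measurableT_comp (mx_measurable_coord 0 k) measurable_snd.
- rewrite (_ : (fun _ => _) = fst); first exact: measurable_fst.
  by apply/funext => p /=; exact: rV_cons0.
Qed.

Section rV_cons_measure.
Context {R : realType} {n : nat}.
Variable mu : {sigma_finite_measure set 'rV[R]_n -> \bar R}.

Definition rV_cons_measure : set 'rV[R]_n.+1 -> \bar R :=
  pushforward (@lebesgue_measure R \x mu)%E (@rV_cons R n).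

Let rV_cons_preimage A : measurable A -> measurable (@rV_cons R n @^-1` A).
Proof.
by move=> mA; rewrite -[X in measurable X]setTI; exact: measurable_rV_cons.
Qed.

Let rV_cons_measure0 : rV_cons_measure set0 = 0%E.
Proof. by rewrite /rV_cons_measure /pushforward preimage_set0 measure0. Qed.

Let rV_cons_measure_ge0 A : (0 <= rV_cons_measure A)%E.
Proof. by rewrite /rV_cons_measure /pushforward; exact: measure_ge0. Qed.

Let rV_cons_measure_sigma_additive : semi_sigma_additive rV_cons_measure.
Proof.
move=> F mF tF mUF; rewrite /rV_cons_measure /pushforward preimage_bigcup.
apply: measure_semi_sigma_additive.
- by move=> k; exact: rV_cons_preimage.
- apply/trivIsetP => /= i j _ _ ij; rewrite -preimage_setI.
  by move/trivIsetP : tF => /(_ _ _ _ _ ij) ->//; rewrite preimage_set0.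
- by rewrite -preimage_bigcup; exact: rV_cons_preimage.
Qed.

HB.instance Definition _ := isMeasure.Build _ _ _ rV_cons_measure
  rV_cons_measure0 rV_cons_measure_ge0 rV_cons_measure_sigma_additive.

Let rV_cons_measure_sigma_finite : sigma_finite setT rV_cons_measure.
Proof.
have /sigma_finiteP[F [TF ndF Foo]] := sigma_finiteT (@lebesgue_measure R).
have /sigma_finiteP[G [TG ndG Goo]] := sigma_finiteT mu.
pose g (x : 'rV[R]_n.+1) : R * 'rV[R]_n :=
  (x 0 0, \row_j x 0 (lift ord0 j)).
have gK : cancel (@rV_cons R n) g.
  move=> [r y]; rewrite /g rV_cons0; congr pair.
  by apply/rowP => j; rewrite mxE rV_consS.
have mg : measurable_fun setT g.
  apply: measurable_fun_pair; first exact: mx_measurable_coord.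
  apply: mx_measurable_funP => i j.
  rewrite (_ : (fun _ => _) = (fun x : 'rV[R]_n.+1 => x 0 (lift ord0 j))).
    exact: mx_measurable_coord.
  by apply/funext => x; rewrite mxE.
exists (fun k => g @^-1` (F k `*` G k)).
  apply/seteqP; split=> // x _; rewrite -preimage_bigcup /=.
  have [k _ Fk] : (\bigcup_i F i) (g x).1 by rewrite -TF.
  have [l _ Gl] : (\bigcup_i G i) (g x).2 by rewrite -TG.
  exists (maxn k l) => //; split.
  - by move: Fk; exact/subsetPset/ndF/leq_maxl.
  - by move: Gl; exact/subsetPset/ndG/leq_maxr.
move=> k; have [mF Fk] := Foo k; have [mG Gk] := Goo k; split.
  by rewrite -[X in measurable X]setTI; apply: mg => //; exact: measurableX.
rewrite /rV_cons_measure /pushforward -comp_preimage.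
rewrite (_ : g \o _ = id) ?preimage_id; last exact/funext.
by rewrite product_measure1E// lte_mul_pinfty// ge0_fin_numE.
Qed.

HB.instance Definition _ := Measure_isSigmaFinite.Build _ _ _ rV_cons_measure
  rV_cons_measure_sigma_finite.

End rV_cons_measure.

Fixpoint lebesgue_rV (R : realType) n :
    {sigma_finite_measure set 'rV[R]_n -> \bar R} :=
  match n with
  | 0 => dirac (0 : 'rV[R]_0)
  | n'.+1 => rV_cons_measure (lebesgue_rV R n')
  end.

Lemma lebesgue_rV_box (R : realType) n (A : 'I_n -> set R) :
  (forall i, measurable (A i)) ->
  lebesgue_rV R n [set x | forall i, A i (x 0 i)] =
  (\prod_i lebesgue_measure (A i))%E.
Proof.
elim: n A => [|n IHn] A mA.
  by rewrite big_ord0 /= diracE mem_set//= => -[].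
rewrite big_ord_recl -(IHn (fun i => A (lift ord0 i)))//.
rewrite /= /rV_cons_measure /pushforward -product_measure1E; first last.
- rewrite [X in measurable X](_ : _ =
    \bigcap_(i in [set: 'I_n]) (fun x : 'rV[R]_n => x 0 i) @^-1` A (lift ord0 i)).
    apply: fin_bigcap_measurable => // i _; rewrite -[X in measurable X]setTI.
    exact: mx_measurable_coord.
  by apply/seteqP; split=> [x Ax i _|x Ax i]; exact: Ax.
- exact: mA.
- congr (product_measure1 _ _ _).
  apply/seteqP; split=> [[r y] /= Ay|[r y] /= [Ar Ay] i].
    split=> [|i]; first by have := Ay 0; rewrite rV_cons0.
    by have := Ay (lift ord0 i); rewrite rV_consS.
  by case: (unliftP ord0 i) => [j ->|->]; rewrite ?rV_consS ?rV_cons0.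
Qed.

Section analysis_notions.
Context {R : realType}.

Definition euclidean_ball N (z : 'rV[R]_N) (r : R) : set 'rV[R]_N :=
  [set y | Num.sqrt (\sum_j (y 0 j - z 0 j) ^+ 2) < r].

Definition C1 m n (g : 'rV[R]_m -> 'rV[R]_n) :=
  (forall x, differentiable g x) /\ continuous (jacobian g).

Definition partial N (j : 'I_N) (g : 'rV[R]_N -> R) : 'rV[R]_N -> R :=
  fun x => 'D_(delta_mx 0 j) g x.

Definition smooth N (g : 'rV[R]_N -> R) :=
  forall s : seq 'I_N, let h := foldr (@partial N) g s in
    continuous h /\ forall x j, derivable h x (delta_mx 0 j).

Definition support_closure N (g : 'rV[R]_N -> R) : set 'rV[R]_N :=
  closure [set x | g x != 0].

Definition probability_density N (g : 'rV[R]_N -> R) :=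
  (forall x, 0 <= g x) /\ (\int[lebesgue_rV R N]_x (g x)%:E = 1)%E.

Definition oriented_integral (t : R) (g : R -> R) : R :=
  if 0 <= t then \int[@lebesgue_measure R]_(s in `[0, t]) g s
  else - \int[@lebesgue_measure R]_(s in `[t, 0]) g s.

(* The flow is taken on all of R (it exists there when b is Lipschitz), so that
   derivatives with respect to time at time 0 are two-sided. *)
Definition is_flow N (b : 'rV[R]_N -> 'rV[R]_N)
    (gamma : R -> 'rV[R]_N -> 'rV[R]_N) :=
  (forall x, continuous (gamma ^~ x)) /\
  forall t x j,
    gamma t x 0 j = x 0 j + oriented_integral t (fun u => b (gamma u x) 0 j).

Definition cadlag N (u : R -> 'rV[R]_N) :=
  (forall t, 0 <= t -> u s @[s --> t^'+] --> u t) /\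
  (forall t, 0 < t -> cvg (u s @[s --> t^'-])).

Definition left_limit N (u : R -> 'rV[R]_N) (t : R) : 'rV[R]_N :=
  lim (u s @[s --> t^'-]).

End analysis_notions.

Section poisson_random_measures.
Context {R : realType} {d : measure_display} {Omega : measurableType d}.
Variable P : probability Omega R.
Local Open Scope ereal_scope.

Definition quadrant : set (R * R) := `[0%R, +oo[ `*` `[0%R, +oo[.

Definition quadrant_measure (A : set (R * R)) : \bar R :=
  (@lebesgue_measure R \x @lebesgue_measure R) (A `&` quadrant).

(* The library's poisson_pmf is constantly 1 at rate 0; here rate 0 gives the
   Dirac mass at 0. *)
Definition poisson_law (X : Omega -> \bar R) (r : R) :=
  forall k : nat,
    P [set w | X w = k%:R%:E] = (r ^+ k / k`!%:R * expR (- r))%R%:E.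

(* Used only for families of set systems containing the full set, for which the
   product rule over all indices entails the one over subfamilies. *)
Definition independent_systems (I : finType) (G : I -> set (set Omega)) :=
  forall E : I -> set Omega, (forall i, G i (E i)) ->
    P (\bigcap_(i in [set: I]) E i) = \prod_i P (E i).

Definition events_of (X : Omega -> \bar R) : set (set Omega) :=
  [set X @^-1` B | B in [set B | measurable B]].

Definition poisson_random_measure
    (M : Omega -> {measure set (R * R) -> \bar R}) :=
  [/\ forall A, measurable A -> measurable_fun setT (M ^~ A),
      forall A, measurable A -> quadrant_measure A < +oo ->
        poisson_law (M ^~ A) (fine (quadrant_measure A)),
      forall A, measurable A -> quadrant_measure A = +oo ->
        {ae P, forall w, M w A = +oo} &
      forall k (A : 'I_k -> set (R * R)), (forall j, measurable (A j)) ->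
        trivIset setT A ->
        independent_systems (fun j => events_of (M ^~ (A j)))].

Definition sigma_of (M : Omega -> {measure set (R * R) -> \bar R}) :
    set (set Omega) :=
  <<s \bigcup_(A in [set A | measurable A]) events_of (M ^~ A) >>.

Definition independent_prms N
    (M : 'I_N -> Omega -> {measure set (R * R) -> \bar R}) :=
  (forall i, poisson_random_measure (M i)) /\
  independent_systems (fun i => sigma_of (M i)).

Definition noise_past N (M : 'I_N -> Omega -> {measure set (R * R) -> \bar R})
    (t : R) : set (set Omega) :=
  <<s [set E | measurable E /\ P E = 0] `|`
      \bigcup_(i in [set: 'I_N])
        \bigcup_(A in [set A : set (R * R) |
                         measurable A /\ A `<=` `[0%R, t] `*` `[0%R, +oo[])
          events_of (M i ^~ A) >>.

End poisson_random_measures.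

Section jump_process.
Context {R : realType} {N : nat}.
Variables (b : 'rV[R]_N -> 'rV[R]_N) (a : 'I_N -> 'rV[R]_N -> 'rV[R]_N).
Variable f : 'I_N -> 'rV[R]_N -> R.

Definition A1 :=
  [/\ forall i, measurable_fun setT (a i), forall i, lipschitz (f i),
      forall i x, 0 < f i x, lipschitz b &
      exists C : R, forall x, `|b x| <= C * (1 + `|x|)].

Definition fbar (x : 'rV[R]_N) : R := \sum_i f i x.

Definition jump (i : 'I_N) (x : 'rV[R]_N) : 'rV[R]_N := x + a i x.

Section solutions.
Context {d : measure_display} {Omega : measurableType d}.
Variable P : probability Omega R.
Variable M : 'I_N -> Omega -> {measure set (R * R) -> \bar R}.

(* The equation at t = 0 forces the initial value x; the processes are defined
   for all times, i.e. do not explode. *)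
Definition is_solution (x : 'rV[R]_N) (X : R -> Omega -> 'rV[R]_N) :=
  [/\ forall t, 0 <= t -> forall B, measurable B ->
        noise_past P M t (X t @^-1` B),
      {ae P, forall w, cadlag (X ^~ w)} &
      {ae P, forall w, forall t, 0 <= t -> forall j,
        X t w 0 j = x 0 j
          + \int[@lebesgue_measure R]_(s in `[0, t]) (b (X s w) 0 j)
          + \sum_(i < N) \int[M i w]_(p in `]0, t] `*` `[0, +oo[)
              (a i (left_limit (X ^~ w) p.1) 0 j
                * (p.2 <= f i (left_limit (X ^~ w) p.1))%R%:R)}].

Definition unique_solutions (X : 'rV[R]_N -> R -> Omega -> 'rV[R]_N) :=
  forall x, is_solution x (X x) /\
    forall Y, is_solution x Y ->
      {ae P, forall w, forall t, 0 <= t -> Y t w = X x t w}.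

Variable X : 'rV[R]_N -> R -> Omega -> 'rV[R]_N.

Definition invariant_probability (m : probability 'rV[R]_N R) :=
  forall t O, 0 <= t -> measurable O ->
    (\int[m]_x P (X x t @^-1` O) = m O)%E.

(* X x is the process under the law with initial value x. *)
Definition A3 (m : probability 'rV[R]_N R) :=
  [/\ invariant_probability m,
      forall m' : probability 'rV[R]_N R,
        invariant_probability m' ->
        forall O, measurable O -> m' O = m O,
      forall O, measurable O -> (0 < m O)%E -> forall x,
        {ae P, forall w,
          limf_esup (fun t => (\1_O (X x t w) : R)%:E) (pinfty_nbhs R) = 1%E} &
      forall i, (\int[m]_x (f i x)%:E < +oo)%E].

End solutions.

Variable gamma : R -> 'rV[R]_N -> 'rV[R]_N.

Definition A2 :=
  forall x,
    (\int[@lebesgue_measure R]_(s in `[0%R, +oo[) (fbar (gamma s x))%:E = +oo)%E.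

Definition survival (x : 'rV[R]_N) (t : R) : R :=
  expR (- \int[@lebesgue_measure R]_(s in `[0, t]) fbar (gamma s x)).

(* Extended-real-valued, so that it acts on all nonnegative measurable functions;
   on indicators it is the transition kernel evaluated at the set. *)
Definition jump_kernel (g : 'rV[R]_N -> \bar R) (x : 'rV[R]_N) : \bar R :=
  (\sum_(i < N) (f i x / fbar x)%:E *
    \int[@lebesgue_measure R]_(t in `[0%R, +oo[)
      ((survival (jump i x) t * fbar (gamma t (jump i x)))%:E
        * g (gamma t (jump i x))))%E.

Definition jump_kernel_iter (k : nat) (x : 'rV[R]_N) (A : set 'rV[R]_N) :
    \bar R :=
  iter k jump_kernel (fun y => (\1_A y)%:E) x.

Section derivation_matrix.
Variables (n : nat) (i : 'I_n.+1 -> 'I_N) (x0 : 'rV[R]_N).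

(* The entry t 0 k is the (k+1)-th time; inord is only used at arguments at most
   n. *)
Fixpoint post_jump (t : 'rV[R]_n.+1) (k : nat) : 'rV[R]_N :=
  if k is k'.+1 then
    jump (i (inord k)) (gamma (t 0 (inord k')) (post_jump t k'))
  else x0.

Definition final_state (t : 'rV[R]_n.+1) : 'rV[R]_N :=
  gamma (t 0 ord_max) (post_jump t n).

(* The library's jacobian acts on row vectors, hence the transpose. *)
Definition derivation_matrix (t : 'rV[R]_n.+1) : 'M[R]_(N, n.+1) :=
  (jacobian final_state t)^T.

End derivation_matrix.

End jump_process.

(* Main.v *)
Require Import Defs.
From HB Require Import structures.
From mathcomp Require Import all_boot all_order all_algebra.
From mathcomp Require Import all_classical all_reals all_analysis.
From mathcomp Require Import measurable_realfun ring lra.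
Import Order.TTheory GRing.Theory Num.Theory numFieldNormedType.Exports.
Local Open Scope classical_set_scope.
Local Open Scope ring_scope.
Set Implicit Arguments.
Unset Strict Implicit.
Unset Printing Implicit Defensive.

(** Why the bound holds.

Consider the scenario in which the successive jumps have the marks [i] and occur
within short times. Near the trajectories that are followed, all the rates that
enter the jump kernel are bounded below, so the probability of this scenario is
at least a constant times Lebesgue measure on the cube of jump times; hence the
iterated kernel dominates a constant times the image of Lebesgue measure on a
small cube of times under the final position of the chain
([jump_kernel_iter_ge]).

It remains to see that this image dominates Lebesgue measure on a fixed ball,
with constants that do not depend on the starting point as long as it stays near
[z0] ([strict_derivative_minorization]). By the non-degeneracy assumption at the
position reached from [z0] by the first jump, the derivative at time zero of the
final position with respect to the jump times is onto.

Only the flow near time zero matters. There the flow of a Lipschitz field is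
strictly differentiable jointly in time and space ([flow_strict_derivative]),
because over a time [t] the difference of two trajectories changes by at most a
multiple of [t] times their distance. Strict derivatives compose, and the final
position is thus strictly differentiable in the jump times at time zero,
uniformly in the starting point ([strict_derivative_final_state]). This is the
estimate behind the Newton-like contraction of [local_surjection]. Extra linear
coordinates are appended to the final position to turn the surjective derivative
into an invertible one.

The image of Lebesgue measure is estimated by comparing balls. If [F] is
Lipschitz with constant [L] and maps a small ball onto a neighbourhood of [z],
then the preimage of the ball of radius [s] around [z] contains a ball of radius
[s / L], so its measure is at least a constant times that of the ball around
[z]. Averaging this over a closed set [K] with Tonelli's theorem compares [K]
with the preimage of a thickening of [K]; letting the thickening shrink gives
the comparison for closed sets ([closed_comparison]), and inner regularity gives
it for Borel sets ([measurable_comparison]).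

Finally, a smooth density supported in the ball is bounded by a multiple of the
indicator function of that ball ([bump_density]). *)

(** * Norms, continuity and derivatives *)

Lemma rV_norm_le (R : realType) n (v : 'rV[R]_n) (r : R) :
  0 <= r -> (forall j, `|v 0 j| <= r) -> `|v| <= r.
Proof.
move=> r0 vr; rewrite [`|v|]mx_normrE; apply/bigmax_leP; split=> // -[i j] _ /=.
by rewrite ord1.
Qed.

Lemma mx_coord_le (R : realType) m n (A : 'M[R]_(m, n)) i j : `|A i j| <= `|A|.
Proof.
rewrite [`|A|]mx_normrE.
by apply: le_bigmax_seq (mem_index_enum ((i, j) : 'I_m * 'I_n)) isT.
Qed.

Lemma rV_coord_le (R : realType) n (v : 'rV[R]_n) j : `|v 0 j| <= `|v|.
Proof. exact: mx_coord_le. Qed.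

Lemma rV_norm_lt (R : realType) n (v : 'rV[R]_n) (r : R) :
  0 < r -> (`|v| < r <-> forall j, `|v 0 j| < r).
Proof.
move=> r0; split=> [vr j|vr]; first by apply: le_lt_trans vr; exact: rV_coord_le.
rewrite [`|v|]mx_normrE; apply/bigmax_ltP; split=> // -[i j] _ /=.
by rewrite ord1.
Qed.

Lemma mem_ballP (R : realType) (V : normedModType R) (x : V) (e : R) (y : V) :
  ball x e y <-> `|x - y| < e.
Proof. by rewrite -ball_normE. Qed.

Lemma lipschitz_bound (R : realType) (V W : normedModType R) (g : V -> W) :
  lipschitz g -> exists2 L : R, 0 < L & forall x y, `|g x - g y| <= L * `|x - y|.
Proof.
move=> [M [Mr HM]]; exists (`|M| + 1); first by rewrite ltr_pwDr.
move=> x y; have := HM (`|M| + 1); rewrite (le_lt_trans (ler_norm _)) ?ltrDl//.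
by move=> /(_ isT (x, y)); apply.
Qed.

Lemma lipschitz_continuous (R : realType) (V W : normedModType R) (g : V -> W) :
  lipschitz g -> continuous g.
Proof.
move=> /lipschitz_bound[L L0 gL] x; apply/cvgrPdist_lt => e e0; near=> y.
apply: le_lt_trans (gL _ _) _; rewrite -ltr_pdivlMl//.
near: y; apply/nbhs_ballP; exists (L^-1 * e); last by move=> z; rewrite mem_ballP.
by rewrite /= mulr_gt0// invr_gt0.
Unshelve. all: by end_near. Qed.

Lemma mulmx_norm_le (R : realType) m n (v : 'rV[R]_m) (A : 'M[R]_(m, n)) :
  `|v *m A| <= m%:R * `|A| * `|v|.
Proof.
apply: rV_norm_le => [|j]; first by rewrite !mulr_ge0.
rewrite mxE (le_trans (ler_norm_sum _ _ _))//.
apply: le_trans (_ : \sum_(k < m) `|A| * `|v| <= _).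
  by apply: ler_sum => k _; rewrite normrM mulrC ler_pM// ?mx_coord_le ?rV_coord_le.
by rewrite sumr_const card_ord -[leRHS]mulrA mulr_natl.
Qed.

Lemma continuous_dist_lt (R : realType) (V W : normedModType R) (g : V -> W) x (e : R) :
  continuous g -> 0 < e ->
  exists2 r : R, 0 < r & forall y, `|y - x| < r -> `|g y - g x| < e.
Proof.
move=> cg e0; have /nbhs_ballP[r /= r0 rP] : \forall y \near x, `|g x - g y| < e.
  by have /cvgrPdist_lt := cg x; exact.
by exists r => // y yx; rewrite distrC; apply: rP; apply/mem_ballP; rewrite distrC.
Qed.

Lemma continuous_sum (R : realType) (T : topologicalType) (I : finType)
    (g : I -> T -> R) :
  (forall i, continuous (g i)) -> continuous (fun x => \sum_i g i x).
Proof.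
by move=> cg x; apply: cvg_big => [|i _]; [exact: add_continuous|exact: cg].
Qed.

Lemma continuous_prod (R : realType) (T : topologicalType) (I : finType)
    (g : I -> T -> R) :
  (forall i, continuous (g i)) -> continuous (fun x => \prod_i g i x).
Proof.
by move=> cg x; apply: cvg_big => [|i _]; [exact: mul_continuous|exact: cg].
Qed.

Lemma continuous_div (R : realType) (T : topologicalType) (g h : T -> R) :
  continuous g -> continuous h -> (forall x, h x != 0) ->
  continuous (fun x => g x / h x).
Proof.
by move=> cg ch h0 x; apply: cvgM; [exact: cg|apply: cvgV; [exact: h0|exact: ch]].
Qed.

Lemma continuous_affine (R : realType) (T : topologicalType) (r s : R) (g : T -> R) :
  continuous g -> continuous (fun x => r * (g x - s)).
Proof.
by move=> cg x; apply: cvgM; [exact: cvg_cst|apply: cvgB; [exact: cg|exact: cvg_cst]].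
Qed.

Lemma continuous_compose (T U V : topologicalType) (g : T -> U) (h : U -> V) :
  continuous g -> continuous h -> continuous (fun x => h (g x)).
Proof. by move=> cg ch x; apply: cvg_comp; [exact: cg|exact: ch]. Qed.

Lemma is_derive_ext (R : numFieldType) (V W : normedModType R) (f g : V -> W)
    (x v : V) (df dg : W) :
  is_derive x v f df -> f =1 g -> df = dg -> is_derive x v g dg.
Proof. by move=> fd /funext <- <-. Qed.

(** Reduces directional derivatives to derivatives of functions of one variable. *)
Lemma is_derive_line (R : realType) (V W : normedModType R) (g : V -> W) (y v : V) d :
  is_derive (0 : R) (1 : R) (fun h => g (h *: v + y)) d -> is_derive y v g d.
Proof.
have E : (fun h : R => h^-1 *: (((fun h => g (h *: v + y)) \o shift 0) (h *: (1:R))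
      - g (0 *: v + y))) = (fun h => h^-1 *: ((g \o shift y) (h *: v) - g y)).
  apply/funext => h /=; have -> : h *: (1:R) = h by exact: mulr1.
  by rewrite addr0 scale0r add0r.
move=> [dg Dg]; apply: DeriveDef.
  by move: dg; rewrite /derivable E.
by move: Dg; rewrite /derive E.
Qed.

Lemma rV_mean_value (R : realType) n (h dh : R -> 'rV[R]_n) (s t M : R) :
  (forall u j, is_derive u (1:R) (fun v => h v 0 j) (dh u 0 j)) ->
  (forall u, Num.min s t <= u <= Num.max s t -> `|dh u| <= M) ->
  `|h t - h s| <= M * `|t - s|.
Proof.
move=> dhP; wlog st : s t / s <= t.
  move=> W hM; have [/W|/ltW/W] := leP s t; first exact.
  by rewrite distrC [`|t - s|]distrC; apply; rewrite minC maxC.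
rewrite (min_l st) (max_r st) => hM.
have M0 : 0 <= M by apply: le_trans (hM s _); rewrite ?lexx ?st.
apply: rV_norm_le => [|j]; first by rewrite mulr_ge0.
have [|c cst hc] := @MVT_segment _ (fun v => h v 0 j) (fun u => dh u 0 j) s t st
    (fun u _ => dhP u j).
  apply: continuous_subspaceT => u; apply: differentiable_continuous.
  by apply/derivable1_diffP; apply: ex_derive.
rewrite !mxE [X in `|X|]hc normrM ler_wpM2r//.
by apply: le_trans (rV_coord_le _ _) _; apply: hM; move: cst; rewrite in_itv.
Qed.

(** An infimum is 0 by convention when the set has no lower bound, so its
    positivity makes it a genuine lower bound. *)
Lemma inf_range_gt0 (R : realType) (T : Type) (g : T -> R) x :
  0 < inf (range g) -> 0 < g x.
Proof.
move=> g0; apply: lt_le_trans (g0) _; apply: ge_inf; last by exists x.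
suff [] : has_inf (range g) by [].
by apply: contrapT => /inf_out g_inf; rewrite g_inf ltxx in g0.
Qed.

(** * The flow of a Lipschitz vector field *)

Section flow.
Context {R : realType} {N : nat}.
Variables (b : 'rV[R]_N -> 'rV[R]_N) (gamma : R -> 'rV[R]_N -> 'rV[R]_N).
Hypotheses (hgamma : is_flow b gamma) (hb : lipschitz b).

Lemma flow0 x : gamma 0 x = x.
Proof.
apply/rowP => j; rewrite (hgamma.2 0 x j) /oriented_integral lexx.
by rewrite set_itv1 Rintegral_set1 addr0.
Qed.

Let continuous_b : continuous b := lipschitz_continuous hb.

Lemma continuous_flow_field x j : continuous (fun u => b (gamma u x) 0 j).
Proof.
move=> u; apply: (@continuous_comp _ _ _ (fun u => b (gamma u x)) (fun v => v 0 j)).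
  apply: continuous_comp; first exact: hgamma.1.
  exact: continuous_b.
exact: coord_continuous.
Qed.

(** Writing the oriented integral with a fixed lower end far to the left lets the
    fundamental theorem of calculus apply at every time, time 0 included. *)
Lemma oriented_integral_shift (g : R -> R) (a t : R) : continuous g ->
  a <= 0 -> a <= t ->
  oriented_integral t g = \int[lebesgue_measure]_(s in `[a, t]) g s
    - \int[lebesgue_measure]_(s in `[a, 0]) g s.
Proof.
move=> cg a0 at_; have ig u v : lebesgue_measure.-integrable `[u, v] (EFin \o g).
  apply: continuous_compact_integrable; first exact: segment_compact.
  exact: continuous_subspaceT.
have key u v : a <= u -> u <= v ->
  \int[lebesgue_measure]_(s in `[a, v]) g s
    - \int[lebesgue_measure]_(s in `[a, u]) g s
    = \int[lebesgue_measure]_(s in `[u, v]) g s.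
  move=> au uv; rewrite (Rintegral_itvB (ig a v)) ?bnd_simp//.
  rewrite Rintegral_itv_obnd_cbnd//.
  by apply: integrableS (ig u v) => //; apply: subset_itv; rewrite bnd_simp.
rewrite /oriented_integral; case: ifPn => [t0|]; first by rewrite key.
by rewrite -ltNge => t0; rewrite -(key t 0) ?(ltW t0)// opprB.
Qed.

Lemma is_derive_flow x j t :
  is_derive t (1:R) (fun s => gamma s x 0 j) (b (gamma t x) 0 j).
Proof.
pose g u := b (gamma u x) 0 j; have cg : continuous g := @continuous_flow_field x j.
pose a := - `|t| - 1.
have a0 : a < 0 by rewrite /a; have := normr_ge0 t; lra.
have at_ : a < t by rewrite /a; have := ler_norm (- t); rewrite normrN; lra.
pose c := x 0 j - \int[lebesgue_measure]_(s in `[a, 0]) g s.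
pose F s : R := \int[lebesgue_measure]_(u in `[a, s]) g u.
have [dF F't] : derivable F t 1 /\ F^`()%classic t = g t.
  apply: (@continuous_FTC1_closed _ g a t (t + 1)) => //; first by rewrite ltrDl.
    apply: continuous_compact_integrable; first exact: segment_compact.
    exact: continuous_subspaceT.
  exact: cg.
have dFc : is_derive t (1:R) (fun s => c + F s) (g t).
  rewrite -[g t]add0r; apply: is_deriveD.
  by rewrite -F't derive1E; apply: DeriveDef.
apply: near_eq_is_derive dFc.
near=> s; rewrite (hgamma.2 s x j).
rewrite (@oriented_integral_shift g a s cg (ltW a0))/=; last first.
  by apply: ltW; near: s; exact: lt_nbhsr.
by rewrite /c /F addrCA addrC.
Unshelve. all: by end_near. Qed.

(** A substitute for Gronwall's inequality: on a time interval of half-length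
    [(2 * L)^-1] the largest distance [m] between the two trajectories exceeds the
    distance at the centre by at most [m / 2]. *)
Lemma flow_lipschitz_short (L : R) x y (t s : R) : 0 < L ->
  (forall x y, `|b x - b y| <= L * `|x - y|) -> `|s - t| <= (2 * L)^-1 ->
  `|gamma s x - gamma s y| <= 2 * `|gamma t x - gamma t y|.
Proof.
move=> L0 bL st; pose h := (2 * L)^-1; have h0 : 0 < h by rewrite invr_gt0 mulr_gt0.
pose D u := gamma u x - gamma u y.
have cD : continuous (fun u => `|D u|).
  move=> u; apply: (@continuous_comp _ _ _ D (fun v => `|v|)).
    by apply: continuousB; exact: hgamma.1.
  exact: norm_continuous.
have [|c cI cmax] := @EVT_max _ (fun u => `|D u|) (t - h) (t + h) _
    (continuous_subspaceT cD); first by lra.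
have inI u : `|u - t| <= h -> u \in `[t - h, t + h].
  by rewrite ler_norml in_itv/= => /andP[]; lra.
have Ic u : u \in `[t - h, t + h] -> `|u - t| <= h.
  by rewrite in_itv/= ler_norml => /andP[]; lra.
have dD u j : is_derive u (1:R) (fun s => D s 0 j)
    ((b (gamma u x) - b (gamma u y)) 0 j).
  rewrite !mxE (_ : (fun t => _) = (fun t => gamma t x 0 j - gamma t y 0 j)).
    by apply: is_deriveB; exact: is_derive_flow.
  by apply/funext => v; rewrite !mxE.
have Dct : `|D c - D t| <= L * `|D c| * `|c - t|.
  apply: (rV_mean_value dD) => u utc; apply: le_trans (bL _ _) _.
  rewrite ler_pM2l//; apply: cmax; apply: inI.
  have := Ic _ cI; move: utc; rewrite !ler_norml.
  by case: (leP t c) => tc /andP[? ?] /andP[? ?]; apply/andP; split; lra.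
have Dc : `|D c| <= 2 * `|D t|.
  have : L * `|D c| * `|c - t| <= `|D c| / 2.
    apply: le_trans (_ : L * `|D c| * h <= _).
      by rewrite ler_wpM2l ?mulr_ge0// ?(ltW L0)// Ic.
    by rewrite /h le_eqVlt; apply/orP; left; apply/eqP; field; rewrite gt_eqF.
  have := ler_normB (D c - D t) (- D t); rewrite opprK subrK normrN; lra.
by apply: le_trans Dc; apply: cmax; exact: inI.
Qed.

(** Chaining the estimate on short intervals covers every bounded time interval. *)
Lemma flow_lipschitz (t : R) : exists2 C : R, 0 < C &
  forall s x y, `|s| <= `|t| -> `|gamma s x - gamma s y| <= C * `|x - y|.
Proof.
have [L L0 bL] := lipschitz_bound hb.
have h0 : 0 < (2 * L)^-1 by rewrite invr_gt0 mulr_gt0.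
have key m : forall s x y, `|s| <= m%:R * (2 * L)^-1 ->
    `|gamma s x - gamma s y| <= 2 ^+ m * `|x - y|.
  elim: m => [|m IH] s x y.
    by rewrite mul0r normr_le0 => /eqP ->; rewrite !flow0 expr0 mul1r.
  move=> sm; pose t0 := s * (m%:R / m.+1%:R).
  have m0 : (0 : R) < m.+1%:R by rewrite ltr0n.
  have /IH tx : `|t0| <= m%:R * (2 * L)^-1.
    rewrite /t0 normrM (ger0_norm (_ : 0 <= _ / _)) ?divr_ge0 ?ler0n//.
    by rewrite mulrCA ler_wpM2l ?ler0n// ler_pdivrMr// [leRHS]mulrC.
  have st : `|s - t0| <= (2 * L)^-1.
    have -> : s - t0 = s / m.+1%:R.
      by rewrite /t0 -natr1; field; rewrite natr1 gt_eqF.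
    rewrite normrM [X in _ * X]gtr0_norm ?invr_gt0//.
    by rewrite ler_pdivrMr// mulrC.
  apply: le_trans (flow_lipschitz_short x y L0 bL st) _.
  by rewrite exprS -mulrA ler_pM2l.
have [m tm] : exists m : nat, `|t| <= m%:R * (2 * L)^-1.
  exists (Num.truncn (`|t| * (2 * L))).+1.
  by rewrite ler_pdivlMr ?mulr_gt0// ltW// truncnS_gt.
exists (2 ^+ m); first by rewrite exprn_gt0.
by move=> s x y st; apply: key; exact: le_trans st tm.
Qed.

Lemma flow_near t x (e : R) : 0 < e -> exists2 r : R, 0 < r &
  forall s y, `|s - t| < r -> `|y - x| < r -> `|gamma s y - gamma t x| < e.
Proof.
move=> e0; have [C C0 HC] := flow_lipschitz (`|t| + 1).
have e20 : 0 < e / 2 by rewrite divr_gt0.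
have /nbhs_ballP[r /= r0 rP] : \forall s \near t, `|gamma t x - gamma s x| < e / 2.
  have := hgamma.1 x t; move/cvgrPdist_lt; exact.
exists (Num.min 1 (Num.min r (e / 2 / C))).
  by rewrite !lt_min ltr01 r0 divr_gt0.
move=> s y; rewrite !lt_min => /and3P[s1 sr _] /and3P[_ _ yr].
rewrite -(subrKA (gamma s x)) (splitr e) (le_lt_trans (ler_normD _ _))// ltrD//.
  apply: le_lt_trans (HC _ _ _ _) _; last by rewrite -ltr_pdivlMl// mulrC.
  rewrite [leRHS]ger0_norm ?addr_ge0// -[s](subrK t) addrC.
  by rewrite (le_trans (ler_normD _ _))// lerD2l ltW.
by rewrite distrC; apply: rP; apply/mem_ballP; rewrite distrC.
Qed.

(** The increment splits into a move in time along one trajectory, where the speed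
    stays close to [b x] by continuity, and a move in space at a fixed small time,
    where the flow differs from the identity by a map of small Lipschitz constant. *)
Lemma flow_strict_derivative x (e : R) : 0 < e -> exists2 r : R, 0 < r &
  forall s t y z, `|s| < r -> `|t| < r -> `|y - x| < r -> `|z - x| < r ->
    `|gamma t z - gamma s y - (z - y) - (t - s) *: b x|
      <= e * (`|t - s| + `|z - y|).
Proof.
move=> e0; have [L L0 bL] := lipschitz_bound hb.
have [C C0 HC] := flow_lipschitz 1.
have eL0 : 0 < e / L by rewrite divr_gt0.
have [r r0 rP] := flow_near 0 x eL0.
exists (Num.min 1 (Num.min r (e / (L * C)))).
  by rewrite !lt_min ltr01 r0 divr_gt0// mulr_gt0.
move=> s t y z; rewrite !lt_min => /and3P[s1 sr se] /and3P[t1 tr te].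
move=> /and3P[_ yr _] /and3P[_ zr _].
have A : `|gamma t z - gamma s z - (t - s) *: b x| <= e * `|t - s|.
  pose h u := gamma u z - u *: b x.
  have -> : gamma t z - gamma s z - (t - s) *: b x = h t - h s.
    by rewrite /h scalerBl; apply/rowP => j; rewrite !mxE; ring.
  have dh u j : is_derive u (1:R) (fun s => h s 0 j) ((b (gamma u z) - b x) 0 j).
    rewrite !mxE (_ : (fun t => _) = (fun t => gamma t z 0 j - b x 0 j *: t)).
      apply: is_deriveB; first exact: is_derive_flow.
      rewrite -[X in is_derive _ _ _ X]mulr1; exact: is_deriveZ.
    by apply/funext => v; rewrite !mxE mulrC.
  apply: (rV_mean_value dh) => u ust; apply: le_trans (bL _ _) _.
  rewrite -ler_pdivlMl// mulrC ltW// -(flow0 x); apply: rP => //.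
  rewrite subr0; move: ust sr tr; rewrite !ltr_norml.
  by case: (leP s t) => ? /andP[? ?] /andP[? ?] /andP[? ?]; apply/andP; split; lra.
have B : `|gamma s z - gamma s y - (z - y)| <= e * `|z - y|.
  pose h u := gamma u z - gamma u y.
  have -> : gamma s z - gamma s y - (z - y) = h s - h 0 by rewrite /h !flow0.
  have dh u j : is_derive u (1:R) (fun s => h s 0 j)
      ((b (gamma u z) - b (gamma u y)) 0 j).
    rewrite !mxE (_ : (fun t => _) = (fun t => gamma t z 0 j - gamma t y 0 j)).
      by apply: is_deriveB; exact: is_derive_flow.
    by apply/funext => v; rewrite !mxE.
  apply: le_trans (_ : L * C * `|z - y| * `|s - 0| <= _).
    apply: (rV_mean_value dh) => u us; apply: le_trans (bL _ _) _.
    rewrite -mulrA ler_pM2l//; apply: HC; rewrite normr1 ler_norml.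
    move: us s1; rewrite ltr_norml.
    by case: (leP 0 s) => ? /andP[? ?] /andP[? ?]; apply/andP; split; lra.
  rewrite subr0 mulrAC ler_wpM2r//.
  by move: se; rewrite ltr_pdivlMr ?mulr_gt0// mulrC; exact: ltW.
have -> : gamma t z - gamma s y - (z - y) - (t - s) *: b x =
   (gamma t z - gamma s z - (t - s) *: b x) + (gamma s z - gamma s y - (z - y)).
  by apply/rowP => j; rewrite !mxE; ring.
by rewrite mulrDr (le_trans (ler_normD _ _))// lerD.
Qed.

End flow.

(** * Strict differentiability at time zero *)

Section strict_derivatives.
Context {R : realType}.

(** Unlike the usual derivative at a point, this one controls increments between
    any two points near [x]; this is what makes perturbed maps locally onto. *)
Definition strict_derivative m n (h : 'rV[R]_m -> 'rV[R]_n) x (J : 'M[R]_(m, n)) :=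
  forall e : R, 0 < e -> exists2 r : R, 0 < r & forall y z,
    `|y - x| < r -> `|z - x| < r -> `|h z - h y - (z - y) *m J| <= e * `|z - y|.

Lemma C1_strict_derivative m n (h : 'rV[R]_m -> 'rV[R]_n) x :
  C1 h -> strict_derivative h x (jacobian h x).
Proof.
move=> [dh cJ] e e0; pose c : R := m%:R + 1.
have c0 : 0 < c by rewrite ltr_wpDl.
have /nbhs_ballP[r /= r0 rP] : \forall y \near x, `|jacobian h x - jacobian h y| < e / c.
  by have /cvgrPdist_lt := cJ x; apply; rewrite divr_gt0.
exists r => // y z yx zx; set J := jacobian h x.
pose w := z - y; pose p (s : R) := h (s *: w + y) - s *: (w *m J).
have -> : h z - h y - (z - y) *m J = p 1 - p 0.
  by rewrite /p !scale1r !scale0r add0r subr0 /w subrK addrAC.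
have dp u j : is_derive u (1:R) (fun s => p s 0 j)
    ((w *m (jacobian h (u *: w + y) - J)) 0 j).
  rewrite mulmxBr !mxE.
  rewrite (_ : (fun t => _) = (fun s => h (s *: w + y) 0 j - (w *m J) 0 j *: s)); last first.
    by apply/funext => s; rewrite !mxE [in RHS]/GRing.scale/= [in RHS]mulrC.
  apply: is_deriveB; last first.
    by rewrite -[X in is_derive _ _ _ X]mulr1 !mxE; exact: is_deriveZ.
  have quotE : (fun k : R => k^-1 *: (((fun s : R => h (s *: w + y)) \o shift u) (k *: (1:R))
        - h (u *: w + y))) =
      (fun k => k^-1 *: ((h \o shift (u *: w + y)) (k *: w) - h (u *: w + y))).
    apply/funext => k /=; have -> : k *: (1:R) = k by exact: mulr1.
    by rewrite scalerDl addrA.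
  have D1 : 'D_1 (fun s : R => h (s *: w + y)) u = w *m jacobian h (u *: w + y).
    by rewrite -(deriveEjacobian w (dh _)) /derive quotE.
  have dv : derivable (fun s : R => h (s *: w + y)) u 1.
    by rewrite /derivable quotE; exact: diff_derivable.
  have -> : \sum_j0 w 0 j0 * jacobian h (u *: w + y) j0 j =
      (w *m jacobian h (u *: w + y)) 0 j by rewrite mxE.
  rewrite -D1 derive_mx// mxE; apply: DeriveDef => //.
  by move/derivable_mxP : dv; exact.
apply: le_trans (_ : e * `|w| * `|1 - 0| <= _); last by rewrite subr0 normr1 mulr1.
apply: (rV_mean_value dp) => u; rewrite (min_l ler01) (max_r ler01) => /andP[u0 u1].
apply: le_trans (mulmx_norm_le _ _) _.
rewrite ler_wpM2r//; apply: le_trans (_ : c * (e / c) <= _); last first.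
  by rewrite mulrCA divff ?gt_eqF// mulr1.
rewrite ler_pM//; first by rewrite lerDl.
rewrite distrC ltW//; apply: rP; apply/mem_ballP; rewrite distrC.
have -> : u *: w + y - x = u *: (z - x) + (1 - u) *: (y - x).
  by apply/rowP => j; rewrite !mxE; ring.
apply: le_lt_trans (ler_normD _ _) _; rewrite !normrZ ger0_norm// ger0_norm ?subr_ge0//.
have : u * `|z - x| <= u * r by rewrite ler_wpM2l// ltW.
have [->|u0'] := eqVneq u 0; first by rewrite !mul0r subr0 mul1r add0r.
have : u * `|z - x| < u * r by rewrite ltr_pM2l// lt_neqAle eq_sym u0'.
have : (1 - u) * `|y - x| <= (1 - u) * r by rewrite ler_wpM2l ?subr_ge0// ltW.
by move=> *; lra.
Qed.

(** Strict differentiability at time 0 in the second variable, uniform in a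
    parameter near [x0]; the first clause, continuity at [(x0, 0)], is what makes
    the notion stable under composition. *)
Definition strict_derivative_at0 (V : normedModType R) m n
    (G : V -> 'rV[R]_m -> 'rV[R]_n) (x0 : V) (D : 'M[R]_(m, n)) :=
  (forall e : R, 0 < e -> exists2 r : R, 0 < r & forall x t,
    `|x - x0| < r -> `|t| < r -> `|G x t - G x0 0| < e) /\
  (forall e : R, 0 < e -> exists2 r : R, 0 < r & forall x s t,
    `|x - x0| < r -> `|s| < r -> `|t| < r ->
    `|G x t - G x s - (t - s) *m D| <= e * `|t - s|).

Lemma strict_derivative_at0_lipschitz (V : normedModType R) m n
    (G : V -> 'rV[R]_m -> 'rV[R]_n) (x0 : V) (D : 'M[R]_(m, n)) :
  strict_derivative_at0 G x0 D -> exists2 C : R, 0 < C &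
    exists2 r : R, 0 < r & forall x s t,
    `|x - x0| < r -> `|s| < r -> `|t| < r -> `|G x t - G x s| <= C * `|t - s|.
Proof.
move=> [_ /(_ _ ltr01)[r r0 rP]]; exists (1 + m%:R * `|D|).
  by rewrite ltr_pwDl// mulr_ge0.
exists r => // x s t xr sr tr; rewrite -[_ - _](subrK ((t - s) *m D)).
by rewrite (le_trans (ler_normD _ _))// mulrDl lerD ?rP// mulmx_norm_le.
Qed.

Lemma strict_derivative_at0_comp (V : normedModType R) m n p
    (G : V -> 'rV[R]_m -> 'rV[R]_n) (x0 : V) (D : 'M[R]_(m, n))
    (h : 'rV[R]_n -> 'rV[R]_p) J :
  strict_derivative_at0 G x0 D -> strict_derivative h (G x0 0) J ->
  strict_derivative_at0 (fun x t => h (G x t)) x0 (D *m J).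
Proof.
move=> GD hJ; have [C C0 [r1 r10 GC]] := strict_derivative_at0_lipschitz GD.
case: GD => Gc GD; split=> e e0.
  have [r r0 rP] := hJ 1 ltr01.
  pose c := 1 + n%:R * `|J|; have c0 : 0 < c by rewrite ltr_pwDl// mulr_ge0.
  have [|q q0 qP] := Gc (Num.min r (e / c)); first by rewrite lt_min r0 divr_gt0.
  exists q => // x t xq tq; have := qP x t xq tq; rewrite lt_min => /andP[Gr Ge].
  rewrite -[_ - _](subrK ((G x t - G x0 0) *m J)).
  apply: le_lt_trans (ler_normD _ _) _.
  apply: le_lt_trans (_ : c * `|G x t - G x0 0| < _).
    by rewrite mulrDl lerD ?mulmx_norm_le// rP// subrr normr0.
  by rewrite -ltr_pdivlMl// mulrC.
pose c := n%:R * `|J| + 1; have c0 : 0 < c by rewrite ltr_wpDl// mulr_ge0.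
have [|r2 r20 hr] := hJ (e / 2 / C); first by rewrite !divr_gt0.
have [//|r3 r30 Gr] := Gc r2.
have [|r4 r40 GDr] := GD (e / 2 / c); first by rewrite !divr_gt0.
exists (Num.min r1 (Num.min r3 r4)); first by rewrite !lt_min r10 r30.
move=> x s t; rewrite !lt_min => /and3P[x1 x3 x4] /and3P[s1 s3 s4] /and3P[t1 t3 t4].
have -> : h (G x t) - h (G x s) - (t - s) *m (D *m J) =
  (h (G x t) - h (G x s) - (G x t - G x s) *m J)
   + (G x t - G x s - (t - s) *m D) *m J.
  by rewrite [X in _ = _ + X]mulmxBl mulmxA addrA subrK.
rewrite (le_trans (ler_normD _ _))// (splitr e) [leRHS]mulrDl lerD//.
  apply: le_trans (hr _ _ (Gr _ _ _ _) (Gr _ _ _ _)) _ => //.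
  apply: le_trans (_ : e / 2 / C * (C * `|t - s|) <= _).
    by rewrite ler_wpM2l ?divr_ge0 ?(ltW e0) ?(ltW C0)// GC.
  by rewrite mulrA divfK ?gt_eqF.
apply: le_trans (mulmx_norm_le _ _) _.
apply: le_trans (_ : c * (e / 2 / c * `|t - s|) <= _).
  by rewrite ler_pM ?mulr_ge0// ?lerDl// GDr.
by rewrite mulrA mulrCA mulfV ?gt_eqF// mulr1.
Qed.

(** Strict derivatives are obtained below by composition, with no formula for
    them; this identifies them with the Jacobian matrix afterwards. *)
Lemma strict_derivative_at0_jacobian (V : normedModType R) m n
    (G : V -> 'rV[R]_m -> 'rV[R]_n) (x0 : V) (D : 'M[R]_(m, n)) :
  strict_derivative_at0 G x0 D -> jacobian (G x0) 0 = D.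
Proof.
move=> [_ GD];
have cD : continuous (mulmxr D : 'rV[R]_m -> 'rV[R]_n).
  apply: lipschitz_continuous; exists (m%:R * `|D|); split; first exact: num_real.
  move=> M DM [x y] _ /=; rewrite -mulmxBl.
  by rewrite (le_trans (mulmx_norm_le _ _))// ler_wpM2r// ltW.
have E : 'd (G x0) 0 = mulmxr D :> (_ -> _).
  apply: diff_unique => //; apply/eqaddoP => e e0.
  have [r r0 rP] := GD e e0.
  apply/nbhs_ballP; exists r => // t /mem_ballP; rewrite sub0r normrN => tr.
  have := rP x0 0 t; rewrite subrr !normr0 !subr0 => /(_ r0 r0 tr).
  have -> : G x0 t - G x0 0 - t *m D = G x0 (t + 0) - (G x0 0 + t *m D).
    by rewrite addr0 opprD addrA.
  exact.
apply/row_matrixP => k; rewrite !rowE.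
by rewrite [LHS]mul_rV_lin1 E.
Qed.

End strict_derivatives.

Section final_state.
Context {R : realType} {N : nat}.
Variables (b : 'rV[R]_N -> 'rV[R]_N) (a : 'I_N -> 'rV[R]_N -> 'rV[R]_N).
Variable gamma : R -> 'rV[R]_N -> 'rV[R]_N.
Hypotheses (hgamma : is_flow b gamma) (hb : lipschitz b) (ha : forall i, C1 (a i)).

Lemma strict_derivative_jump i x :
  strict_derivative (jump a i) x (1%:M + jacobian (a i) x).
Proof.
move=> e e0; have [r r0 rP] := C1_strict_derivative x (ha i) e0.
exists r => // y z yx zx; have := rP y z yx zx; congr (`|_| <= _).
by rewrite /jump mulmxDr mulmx1; apply/rowP => j; rewrite !mxE; ring.
Qed.

Lemma strict_derivative_at0_flow (V : normedModType R) m
    (G : V -> 'rV[R]_m -> 'rV[R]_N) (x0 : V) D j :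
  strict_derivative_at0 G x0 D ->
  strict_derivative_at0 (fun x t => gamma (t 0 j) (G x t)) x0
    (D + delta_mx j (0 : 'I_1) *m b (G x0 0)).
Proof.
move=> GD; have [C C0 [r1 r10 GC]] := strict_derivative_at0_lipschitz GD.
case: GD => Gc GD; split=> e e0.
  rewrite mxE (flow0 hgamma).
  have [r r0 rP] := flow_near hgamma hb 0 (G x0 0) e0.
  have [q q0 qP] := Gc r r0.
  exists (Num.min r q); first by rewrite lt_min r0.
  move=> x t; rewrite !lt_min => /andP[_ xq] /andP[tr tq].
  rewrite -(flow0 hgamma (G x0 0)); apply: rP; last exact: qP.
  by rewrite subr0 (le_lt_trans (rV_coord_le _ _)).
have C10 : 0 < 1 + C by rewrite ltr_wpDl// ltW.
have e20 : 0 < e / 2 / (1 + C) by rewrite !divr_gt0.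
have [r2 r20 fr] := flow_strict_derivative hgamma hb (G x0 0) e20.
have [r3 r30 Gr] := Gc r2 r20.
have [|r4 r40 GDr] := GD (e / 2); first by rewrite divr_gt0.
exists (Num.min (Num.min r1 r2) (Num.min r3 r4)); first by rewrite !lt_min r10 r20 r30.
move=> x s t; rewrite !lt_min => /andP[/andP[x1 x2] /andP[x3 x4]].
move=> /andP[/andP[s1 s2] /andP[s3 s4]] /andP[/andP[t1 t2] /andP[t3 t4]].
have coord (u : 'rV[R]_m) : u *m delta_mx j (0 : 'I_1) = (u 0 j)%:M.
  apply/matrixP => k l; rewrite !ord1 !mxE (bigD1 j)//= big1 => [|i ij].
    by rewrite mxE !eqxx mulr1 addr0.
  by rewrite mxE (negbTE ij) mulr0.
set g := b (G x0 0).
have -> : gamma (t 0 j) (G x t) - gamma (s 0 j) (G x s)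
     - (t - s) *m (D + delta_mx j (0 : 'I_1) *m g) =
  (gamma (t 0 j) (G x t) - gamma (s 0 j) (G x s) - (G x t - G x s)
     - (t 0 j - s 0 j) *: g) + (G x t - G x s - (t - s) *m D).
  rewrite mulmxDr mulmxA coord mul_scalar_mx.
  by apply/rowP => k; rewrite !mxE; ring.
rewrite (le_trans (ler_normD _ _))// (splitr e) [leRHS]mulrDl lerD ?GDr//.
have ts : `|t 0 j - s 0 j| <= `|t - s|.
  by have := rV_coord_le (t - s) j; rewrite !mxE.
apply: le_trans (fr _ _ _ _ _ _ (Gr _ _ _ _) (Gr _ _ _ _)) _ => //.
- by rewrite (le_lt_trans (rV_coord_le _ _)).
- by rewrite (le_lt_trans (rV_coord_le _ _)).
apply: le_trans (_ : e / 2 / (1 + C) * ((1 + C) * `|t - s|) <= _).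
  by rewrite ler_pM2l// mulrDl mul1r lerD// GC.
by rewrite mulrA divfK ?gt_eqF.
Qed.

Lemma strict_derivative_post_jump n (i : 'I_n.+1 -> 'I_N) x0 k : exists D,
  strict_derivative_at0 (fun x t => post_jump a gamma i x t k) x0 D.
Proof.
elim: k => [|k [D HD]].
  exists 0; split=> e e0; exists e => // x s t xe se te.
  by rewrite /= mulmx0 subrr subr0 normr0 mulr_ge0// ltW.
have HF := strict_derivative_at0_flow (inord k) HD.
by eexists; apply: strict_derivative_at0_comp HF (strict_derivative_jump _ _).
Qed.

Lemma strict_derivative_final_state n (i : 'I_n.+1 -> 'I_N) x0 :
  strict_derivative_at0 (fun x t => final_state a gamma i x t) x0
    (derivation_matrix a gamma i x0 0)^T.
Proof.
have [D HD] := strict_derivative_post_jump i x0 n.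
have HF := strict_derivative_at0_flow ord_max HD.
by rewrite /derivation_matrix trmxK (strict_derivative_at0_jacobian HF).
Qed.

End final_state.

(** * Local surjectivity *)

(** Banach's fixed point theorem is stated for complete normed modules, a structure
    that matrices acquire once completeness is attached to their norm. *)
HB.instance Definition _ (R : realType) m n :=
  Uniform_isComplete.Build 'M[R]_(m, n) (@mx_complete R m n).

(** Solutions of [F u = y] are the fixed points of [u - (F u - y) *m invmx P], which
    contracts the ball by a factor 1/2 because [F] is close to the linear map [P].
    The values reached are at distance at most [r / (2 * c)] from [F u0] so that
    the ball is mapped into itself. *)
Lemma local_surjection (R : realType) d (F : 'rV[R]_d -> 'rV[R]_d)
    (P : 'M[R]_d) u0 (r c e : R) : 0 < r -> 0 < c -> c * e <= 2^-1 ->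
  P \in unitmx -> (forall w : 'rV[R]_d, `|w *m invmx P| <= c * `|w|) ->
  (forall u v, `|u - u0| <= r -> `|v - u0| <= r ->
    `|F v - F u - (v - u) *m P| <= e * `|v - u|) ->
  forall y, `|y - F u0| <= r / (2 * c) ->
    exists2 u, `|u - u0| <= r & F u = y.
Proof.
move=> r0 c0 ce Pu cP FP y yF.
pose U := closed_ball_ (fun x : 'rV[R]_d => `|x|) u0 r.
pose T u := u - (F u - y) *m invmx P.
have TB u v : `|u - u0| <= r -> `|v - u0| <= r -> `|T v - T u| <= 2^-1 * `|v - u|.
  move=> ur vr; have -> : T v - T u = - ((F v - F u - (v - u) *m P) *m invmx P).
    rewrite [in RHS]mulmxBl mulmxK// /T [in RHS](mulmxBl (F v)) !(mulmxBl _ y).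
    by apply/rowP => j; rewrite !mxE; ring.
  rewrite normrN (le_trans (cP _))//.
  apply: le_trans (_ : c * (e * `|v - u|) <= _); first by rewrite ler_pM2l// FP.
  by rewrite mulrA ler_wpM2r.
have TU : {homo T : u / U u >-> U u}.
  move=> u; rewrite /U /closed_ball_/= distrC => ur; rewrite distrC.
  rewrite -(subrK (T u0) (T u)) -addrA (le_trans (ler_normD _ _))//.
  rewrite [leRHS](splitr r) lerD//.
    rewrite (le_trans (TB _ _ _ _))// ?subrr ?normr0 ?(ltW r0)//.
    by rewrite mulrC ler_pM2r.
  rewrite /T addrAC subrr sub0r normrN (le_trans (cP _))// distrC.
  by rewrite mulrC -ler_pdivlMr// -mulrA -invfM.
have ctr : is_contraction (mkfun_fun TU).
  have h0 : 0 <= 2^-1 :> R by rewrite invr_ge0.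
  exists (NngNum h0); split=> [|[v w] [/= Uv Uw]] /=; first by rewrite invf_lt1 ?ltr1n.
  by apply: TB; rewrite distrC.
have [||u Uu uT] := banach_fixed_point ctr.
- exact: closed_closed_ball_.
- by exists u0; rewrite /U /closed_ball_ /= subrr normr0 ltW.
exists u; first by rewrite distrC.
move/esym: uT; rewrite /= /mkfun /T => /eqP.
rewrite -subr_eq0 addrAC subrr sub0r oppr_eq0 => /eqP Fy0.
by apply/eqP; rewrite -subr_eq0 -[F u - y](mulmxKV Pu) Fy0 mul0mx.
Qed.

Lemma row_free_completion (F : fieldType) d N (D : 'M[F]_(d, N)) :
  \rank D = N -> exists p (E : 'M[F]_(d, p)), d = (N + p)%N /\ row_free (row_mx D E).
Proof.
move=> rD; have rA : \rank D^T = N by rewrite mxrank_tr.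
exists (\rank (D^T)^C%MS); exists (row_base (D^T)^C%MS)^T; split.
  by rewrite mxrank_compl rA subnKC// -rD rank_leq_row.
rewrite /row_free -mxrank_tr tr_row_mx trmxK -addsmxE.
rewrite (adds_eqmx (eqmx_refl _) (eq_row_base _)); exact: addsmx_compl_full.
Qed.

Lemma det_mulmx_tr_neq0 (F : fieldType) d N (S : 'M[F]_(N, d)) :
  \det (S *m S^T) != 0 -> \rank S^T = N.
Proof.
rewrite -unitfE -unitmxE -row_full_unit => /eqP rS.
by apply/eqP; rewrite eqn_leq rank_leq_col -{1}rS mxrankM_maxr.
Qed.

(** * Lebesgue measure on row vectors *)

Local Open Scope ereal_scope.

(** Monotonicity of the integral of nonnegative functions holds without
    measurability, since such integrals are suprema over simple functions.  It is
    applied to the iterates of the jump kernel, whose measurability is left aside. *)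
Lemma le_integral_ge0 d (T : measurableType d) (R : realType)
    (mu : {measure set T -> \bar R}) (D1 D2 : set T) (f1 f2 : T -> \bar R) :
  (forall x, D1 x -> 0 <= f1 x)%E -> (forall x, D2 x -> 0 <= f2 x)%E ->
  D1 `<=` D2 -> (forall x, D1 x -> f1 x <= f2 x)%E ->
  (\int[mu]_(x in D1) f1 x <= \int[mu]_(x in D2) f2 x)%E.
Proof.
move=> f10 f20 D12 f12; rewrite integral_mkcond [leRHS]integral_mkcond.
have p1 : forall x, (0 <= (f1 \_ D1) x)%E.
  by move=> x; rewrite patchE; case: ifPn => // /set_mem; exact: f10.
have p2 : forall x, (0 <= (f2 \_ D2) x)%E.
  by move=> x; rewrite patchE; case: ifPn => // /set_mem; exact: f20.
rewrite !ge0_integralTE//; apply: le_ereal_sup => _ [h /= hf <-].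
exists h => // x; apply: le_trans (hf x) _.
rewrite !patchE; case: ifPn => [/set_mem D1x|_].
  by rewrite mem_set; [exact: f12|exact: D12].
by case: ifPn => // /set_mem; exact: f20.
Qed.

Lemma lebesgue_rV_ball (R : realType) d (u : 'rV[R]_d) (r : R) : (0 < r)%R ->
  lebesgue_rV R d (ball u r) = ((r *+ 2) ^+ d)%:E.
Proof.
move=> r0; rewrite (_ : ball u r = [set x | forall i, ball (u 0%R i) r (x 0%R i)]).
  rewrite (lebesgue_rV_box (A := fun i => ball (u 0%R i) r)) => [|i]; last exact: measurable_ball.
  under eq_bigr do rewrite lebesgue_measure_ball ?(ltW r0)//.
  by rewrite prodEFin prodr_const card_ord.
apply/seteqP; split=> x.
  by move/mem_ballP/(rV_norm_lt _ r0) => ux i; apply/mem_ballP; have := ux i; rewrite !mxE.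
move=> ux; apply/mem_ballP/(rV_norm_lt _ r0) => i.
by rewrite !mxE; apply/mem_ballP.
Qed.

Lemma measurable_rV_ball (R : realType) d (u : 'rV[R]_d) (r : R) : measurable (ball u r).
Proof. by apply: mx_open_measurable; exact: ball_open. Qed.

Lemma rV_closed_measurable (R : realType) d (K : set 'rV[R]_d) :
  closed K -> measurable K.
Proof.
move=> cK; rewrite -(setCK K); apply: measurableC; apply: mx_open_measurable.
exact: closed_openC.
Qed.

Local Close Scope ereal_scope.

Lemma rV_continuous_measurable (R : realType) N (g : 'rV[R]_N -> R) :
  continuous g -> measurable_fun setT g.
Proof.
move=> cg; apply: (measurability _ (RGenOpens.measurableE R)) => _ [_ [u [v ->] <-]].
rewrite setTI; apply: mx_open_measurable.
by apply: open_comp; [move=> x _; exact: cg|exact: interval_open].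
Qed.

Lemma measurable_lsubmx (R : realType) m n :
  measurable_fun setT (lsubmx : 'rV[R]_(m + n) -> 'rV[R]_m).
Proof.
apply: mx_measurable_funP => i j.
rewrite (_ : (fun _ => _) = (fun x : 'rV[R]_(m + n) => x i (lshift n j))); last first.
  by apply/funext => x; rewrite !mxE.
exact: mx_measurable_coord.
Qed.

Lemma measurable_rsubmx (R : realType) m n :
  measurable_fun setT (rsubmx : 'rV[R]_(m + n) -> 'rV[R]_n).
Proof.
apply: mx_measurable_funP => i j.
rewrite (_ : (fun _ => _) = (fun x : 'rV[R]_(m + n) => x i (rshift m j))); last first.
  by apply/funext => x; rewrite !mxE.
exact: mx_measurable_coord.
Qed.

(** By induction on the first block: peeling off one coordinate turns both sides
    into integrals of measures of sections. *)
Lemma lebesgue_rV_product (R : realType) m n (A : set 'rV[R]_m) (B : set 'rV[R]_n) :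
  measurable A -> measurable B ->
  lebesgue_rV R (m + n) [set w | A (lsubmx w) /\ B (rsubmx w)] =
  (lebesgue_rV R m A * lebesgue_rV R n B)%E.
Proof.
elim: m A => [|m IHm] A mA mB.
  rewrite [lebesgue_rV R 0 A]diracE.
  have rK (w : 'rV[R]_(0 + n)) : rsubmx w = w.
    by apply/rowP => j; rewrite mxE; congr (w _ _); apply/val_inj.
  have lK (w : 'rV[R]_(0 + n)) : lsubmx w = 0 by apply/rowP; case.
  have [/set_mem A0|A0] := boolP (_ \in A).
    rewrite mul1e; congr (lebesgue_rV R n _); apply/seteqP; split=> w /=.
      by move=> [_]; rewrite rK.
    by rewrite rK lK.
  rewrite mul0e (_ : [set _ | _] = set0) ?measure0// -subset0 => w /= [+ _].
  by rewrite lK => /mem_set; exact/negP.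
rewrite -[LHS]/(product_measure1 lebesgue_measure (lebesgue_rV R (m + n)) _).
rewrite -[lebesgue_rV R m.+1 A]/(product_measure1 lebesgue_measure (lebesgue_rV R m) _).
rewrite /product_measure1.
have mcA : measurable (@rV_cons R m @^-1` A).
  by rewrite -[X in measurable X]setTI; exact: measurable_rV_cons.
have mrA r : measurable (xsection (@rV_cons R m @^-1` A) r) by exact: measurable_xsection.
rewrite -ge0_integralZr//; last exact: measurable_fun_xsection.
apply: eq_integral => r _ /=; rewrite -IHm//; congr (lebesgue_rV R (m + n) _).
have lE (w : 'rV[R]_(m + n)) :
    (lsubmx (rV_cons (r, w) : 'rV_(m.+1 + n)) : 'rV[R]_m.+1) = rV_cons (r, lsubmx w).
  apply/rowP => j; rewrite mxE; case: (unliftP ord0 j) => [k ->|->].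
    rewrite [RHS]rV_consS [in RHS]/= [RHS]mxE -[RHS](rV_consS (r, w)); congr (rV_cons _ _ _).
    exact/val_inj.
  rewrite [RHS]rV_cons0 [in RHS]/= -[RHS](rV_cons0 (r, w)); congr (rV_cons _ _ _).
  exact/val_inj.
have rE (w : 'rV[R]_(m + n)) :
    (rsubmx (rV_cons (r, w) : 'rV_(m.+1 + n)) : 'rV[R]_n) = rsubmx w.
  apply/rowP => j; rewrite [LHS]mxE [RHS]mxE -[RHS](rV_consS (r, w)); congr (rV_cons _ _ _).
  exact/val_inj.
apply/seteqP; split=> w; rewrite /xsection/= !inE /= ?in_setE.
  by rewrite lE rE.
by rewrite lE rE.
Qed.

(** * Images of Lebesgue measure under Lipschitz maps *)

Local Open Scope ereal_scope.

Definition thickening (R : realType) d (K : set 'rV[R]_d) (s : R) : set 'rV[R]_d :=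
  \bigcup_(z in K) ball z s.

Lemma thickening_open (R : realType) d (K : set 'rV[R]_d) s :
  open (thickening K s).
Proof. by apply: bigcup_open => z _; apply: ball_open. Qed.

Lemma bigcap_thickening (R : realType) d (K : set 'rV[R]_d) : closed K ->
  \bigcap_n thickening K n.+1%:R^-1 = K.
Proof.
move=> cK; apply/seteqP; split=> [y yK|y Ky n _]; last first.
  by exists y => //; apply: ballxx; rewrite invr_gt0.
apply: cK => B /nbhs_ballP[e /= e0 eB].
pose n := Num.truncn e^-1.
have [z Kz zy] := yK n I; exists z; split=> //; apply: eB.
apply: ball_sym; apply: le_ball zy.
by rewrite -[leRHS]invrK lef_pV2 ?posrE ?invr_gt0// ltW// truncnS_gt.
Qed.

Lemma cvge_lt_exists (R : realType) (u : nat -> \bar R) (l e : \bar R) :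
  u @ \oo --> l -> l < e -> exists n, u n < e.
Proof.
move=> ul le; apply: contrapT => noN.
have : e <= l.
  rewrite -(cvg_lim _ ul)//; apply: lime_ge; first by apply/cvg_ex; exists l.
  by apply: nearW => n; rewrite leNgt; apply/negP => une; apply: noN; exists n.
by rewrite leNgt le.
Qed.

(** ** Inner regularity of finite Borel measures *)

Section inner_regularity.
Context {R : realType} {d : nat} (nu : {measure set 'rV[R]_d -> \bar R}).
Hypothesis nu_fin : nu setT < +oo.

Let approximable (A : set 'rV[R]_d) := forall e : R, (0 < e)%R ->
  exists K U, [/\ closed K, open U, K `<=` A, A `<=` U & nu (U `\` K) < e%:E].

Let nu_finS A : measurable A -> nu A < +oo.
Proof. by move=> mA; apply: le_lt_trans nu_fin; apply: le_measure; rewrite ?inE. Qed.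

(* An open set is exhausted by the points at distance at least [n.+1^-1] from its
   complement. *)
Let approximable_open U : open U -> approximable U.
Proof.
move=> oU e e0; pose K n := ~` thickening (~` U) n.+1%:R^-1.
have cK n : closed (K n) by apply: open_closedC; exact: thickening_open.
pose F n := U `\` K n.
have mF n : measurable (F n).
  by apply: measurableD; [exact: mx_open_measurable|exact: rV_closed_measurable].
have capF : \bigcap_n F n = set0.
  rewrite -subset0 => x Fx; have /= := bigcap_thickening (open_closedC oU).
  move/seteqP => -[+ _] => /(_ x); apply; last by have [] := Fx 0%N I.
  by move=> n _; have [_ /contrapT] := Fx n I.
have : nu \o F @ \oo --> nu (\bigcap_n F n).
  apply: nonincreasing_cvg_mu => //; first exact: nu_finS.
    by rewrite capF.
  move=> m n mn; apply/subsetPset => x [Ux Kx]; split => //; apply: contra_not Kx => Kx.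
  apply: contra_not Kx => -[z Uz zx]; exists z => //; apply: le_ball zx.
  by rewrite lef_pV2 ?posrE// ler_nat.
rewrite capF measure0 => /cvge_lt_exists /(_ (_ : 0 < e%:E)) [//|n Fn].
exists (K n), U; split=> //.
  move=> x Kx; apply: contrapT => Ux; apply: Kx; exists x => //.
  by apply: ballxx; rewrite invr_gt0.
Qed.

(* A countable union of closed sets need not be closed, but a finite part of it
   already exhausts the measure. *)
Let approximable_sigma_algebra : sigma_algebra setT approximable.
Proof.
split.
- move=> e e0; exists set0, set0; split=> //; first exact: closed0.
  by rewrite setD0 measure0.
- move=> A apA e e0; have [K [U [cK oU KA AU UK]]] := apA e e0.
  exists (~` U), (~` K); rewrite setTD; split.
  + exact: open_closedC. + exact: closed_openC.
  + exact: subsetC. + exact: subsetC.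
  by rewrite setDE setCK setIC -setDE.
move=> A apA e e0.
have e20 : (0 < e / 2)%R by rewrite divr_gt0.
have P n : exists KU : set 'rV[R]_d * set 'rV[R]_d,
    [/\ closed KU.1, open KU.2, KU.1 `<=` A n, A n `<=` KU.2 &
    nu (KU.2 `\` KU.1) <= (e / 2 / (2 ^ n.+1)%:R)%:E].
  have [|K [U [? ? ? ? /ltW ?]]] := apA n (e / 2 / (2 ^ n.+1)%:R)%R.
    by rewrite divr_gt0// ltr0n expn_gt0.
  by exists (K, U).
pose KU n := projT1 (cid (P n)); pose K n := (KU n).1; pose U n := (KU n).2.
have KUP n : [/\ closed (K n), open (U n), K n `<=` A n, A n `<=` U n &
    nu (U n `\` K n) <= (e / 2 / (2 ^ n.+1)%:R)%:E].
  by rewrite /K /U /KU; case: cid.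
pose V := \bigcup_n U n; pose L m := \bigcup_(n < m) K n.
have oV : open V by apply: bigcup_open => n _; have [] := KUP n.
have cL m : closed (L m).
  by apply: closed_bigcup => [|n _]; [exact: finite_II|have [] := KUP n].
pose F m := V `\` L m.
have mF m : measurable (F m).
  by apply: measurableD; [exact: mx_open_measurable|exact: rV_closed_measurable].
have capF : nu (\bigcap_m F m) <= (e / 2)%:E.
  apply: le_trans (epsilon_trick0 xpredT (ltW e20)).
  apply: le_trans (_ : \sum_(n <oo) nu (U n `\` K n) <= _).
    apply: measure_sigma_subadditive.
    - move=> n; have [cK oU _ _ _] := KUP n.
      by apply: measurableD; [exact: mx_open_measurable|exact: rV_closed_measurable].
    - exact: bigcap_measurable.
    move=> x Fx; have [[n _ Ux] _] := Fx 0%N I; exists n => //; split=> // Kx.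
    by have [_ /= Lx] := Fx n.+1 I; apply: Lx; exists n => /=.
  by apply: lee_nneseries => n _ //; have [] := KUP n.
have : nu \o F @ \oo --> nu (\bigcap_n F n).
  apply: nonincreasing_cvg_mu => //; first exact: nu_finS.
    exact: bigcap_measurable.
  move=> m n mn; apply/subsetPset => x [Ux Kx]; split => //; apply: contra_not Kx.
  by move=> [k /= km Kx]; exists k => //=; exact: leq_trans mn.
have ee : nu (\bigcap_n F n) < e%:E.
  by apply: le_lt_trans capF _; rewrite lte_fin ltr_pdivrMr// ltr_pMr// ltr1n.
move=> /cvge_lt_exists /(_ ee)[m Fm].
exists (L m), V; split=> //.
- by move=> x [n _ Kx]; exists n => //; have [_ _ + _ _] := KUP n; apply.
- by move=> x [n _ Ax]; exists n => //; have [_ _ _ + _] := KUP n; apply.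
Qed.

Lemma closed_inner_regular (A : set 'rV[R]_d) (e : R) : measurable A -> (0 < e)%R ->
  exists K, [/\ closed K, K `<=` A & nu A <= nu K + e%:E].
Proof.
move=> mA e0; have apA : approximable A.
  by apply: (smallest_sub approximable_sigma_algebra _ mA) => B; exact: approximable_open.
have [K [U [cK oU KA AU UK]]] := apA e e0.
exists K; split=> //; have mK := rV_closed_measurable cK.
have mU := mx_open_measurable oU.
apply: (@le_trans _ _ (nu (K `|` (U `\` K)))).
  apply: le_measure; rewrite ?inE//; first by apply: measurableU => //; exact: measurableD.
  by move=> x /AU Ux; have [?|?] := pselect (K x); [left|right].
apply: le_trans (measureU2 nu mK (measurableD mU mK)) _.
by rewrite leeD2l// ltW.
Qed.

End inner_regularity.

(** ** Comparison with an image measure *)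

Section comparison.
Context {R : realType} {d : nat}.
Local Notation lambda := (lebesgue_rV R d).
Variables (F : 'rV[R]_d -> 'rV[R]_d) (Q : set 'rV[R]_d) (kappa : R).
Hypotheses (mF : measurable_fun setT F) (mQ : measurable Q) (Qfin : lambda Q < +oo).
Hypothesis kappa0 : (0 < kappa)%R.

Let mFpre A : measurable A -> measurable (Q `&` F @^-1` A).
Proof.
move=> mA; apply: measurableI => //; rewrite -[X in measurable X]setTI.
exact: mF.
Qed.

(** Tonelli's theorem for the set of pairs [(z, u)] with [z] in [K], [u] in [Q] and
    [F u] within [s] of [z].  Its section at [z] is bounded below by assumption;
    its section at [u] lies in a ball of radius [s], and is empty unless [F u] is
    in the thickening of [K].  The volume of that ball cancels. *)
Lemma closed_comparison (K : set 'rV[R]_d) (s : R) : (0 < s)%R -> closed K ->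
  (forall z, K z -> kappa%:E * lambda (ball z s) <= lambda (Q `&` F @^-1` ball z s)) ->
  kappa%:E * lambda K <= lambda (Q `&` F @^-1` thickening K s).
Proof.
move=> s0 cK Ks; have mK := rV_closed_measurable cK.
pose c : R := ((s *+ 2) ^+ d)%R.
have c0 : (0 < c)%R by rewrite exprn_gt0// mulrn_wgt0.
have lball z : lambda (ball z s) = c%:E by rewrite lebesgue_rV_ball.
pose E : set ('rV[R]_d * 'rV[R]_d) := [set zu | K zu.1 /\ Q zu.2 /\ ball zu.1 s (F zu.2)].
have mE : measurable E.
  pose g (zu : 'rV[R]_d * 'rV[R]_d) := (zu.1 - F zu.2)%R.
  have mg : measurable_fun setT g.
    apply: mx_measurable_funP => i j.
    rewrite (_ : (fun _ => _) =
      (fun zu : 'rV[R]_d * 'rV[R]_d => zu.1 i j - F zu.2 i j)%R); last first.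
      by apply/funext => zu; rewrite !mxE.
    apply: measurable_funB.
      exact: (measurableT_comp (mx_measurable_coord i j) measurable_fst).
    apply: (measurableT_comp (mx_measurable_coord i j)).
    exact: measurableT_comp mF measurable_snd.
  rewrite (_ : E = (K `*` Q) `&` g @^-1` (ball 0%R s)).
    apply: measurableI; first exact: measurableX.
    by rewrite -[X in measurable X]setTI; apply: mg => //; exact: measurable_rV_ball.
  apply/seteqP; split=> -[z u] /=.
    move=> [Kz [Qu /mem_ballP zu]]; split=> //; apply/mem_ballP.
    by rewrite sub0r normrN.
  move=> [[Kz Qu] /mem_ballP]; rewrite sub0r normrN => zu; split=> //; split=> //.
  exact/mem_ballP.
have int_indic (k : R) (A : set 'rV[R]_d) : (0 <= k)%R -> measurable A ->
    \int[lambda]_z (k%:E * (\1_A z)%:E) = k%:E * lambda A.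
  move=> k0 mA; rewrite ge0_integralZl//.
  - by rewrite integral_indic// setIT.
  - by apply/measurable_EFinP; exact: measurable_indic.
have mindic (k : R) (A : set 'rV[R]_d) : measurable A ->
    measurable_fun setT (fun z => k%:E * (\1_A z)%:E).
  by move=> mA; apply: measurable_funeM; apply/measurable_EFinP; exact: measurable_indic.
have lower : kappa%:E * lambda K * c%:E <= (lambda \x lambda) E.
  rewrite muleAC -EFinM -int_indic ?mulr_ge0 ?(ltW c0) ?(ltW kappa0)// /product_measure1.
  apply: ge0_le_integral => //.
  - by move=> z _; rewrite mule_ge0// lee_fin// mulr_ge0 ?(ltW c0) ?(ltW kappa0).
  - exact: mindic.
  - exact: measurable_fun_xsection.
  move=> z _ /=; rewrite indicE; have [/set_mem Kz|_] := boolP (z \in K); last first.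
    by rewrite mule0 measure_ge0.
  rewrite mule1 EFinM -(lball z); apply: le_trans (Ks z Kz) _.
  apply: le_measure; rewrite ?inE; first by apply: mFpre; exact: measurable_rV_ball.
    exact: measurable_xsection.
  by move=> u [Qu zFu]; rewrite /xsection/= inE.
have mN : measurable (thickening K s) by apply: mx_open_measurable; exact: thickening_open.
have upper : (lambda \x lambda) E <= c%:E * lambda (Q `&` F @^-1` thickening K s).
  rewrite (@product_measure_unique _ _ _ _ _ lambda lambda (lambda \x^ lambda))//; last first.
    by move=> A B mA mB; exact: product_measure2E.
  rewrite -int_indic ?(ltW c0)//; last exact: mFpre.
  rewrite /= /product_measure2.
  apply: ge0_le_integral => //.
  - exact: measurable_fun_ysection.
  - by apply: mindic; exact: mFpre.
  move=> u _ /=; rewrite indicE.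
  have [/set_mem|] := boolP (u \in Q `&` F @^-1` thickening K s) => [_|/negP uN].
    rewrite mule1 -(lball (F u)); apply: le_measure; rewrite ?inE.
    - exact: measurable_ysection.
    - exact: measurable_rV_ball.
    by move=> z; rewrite /ysection/= inE => -[_ [_]]; exact: ball_sym.
  rewrite mule0 (_ : ysection E u = set0) ?measure0// -subset0 => z.
  rewrite /ysection/= inE => -[Kz [Qu zFu]]; apply: uN; rewrite inE; split=> //.
  by exists z.
by have := le_trans lower upper; rewrite muleC lee_pmul2l.
Qed.

Lemma measurable_comparison (V A : set 'rV[R]_d) : lambda V < +oo ->
  measurable V -> measurable A -> A `<=` V ->
  (forall z s, V z -> (0 < s <= 1)%R ->
    kappa%:E * lambda (ball z s) <= lambda (Q `&` F @^-1` ball z s)) ->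
  kappa%:E * lambda A <= lambda (Q `&` F @^-1` A).
Proof.
move=> Vfin mV mA AV VQ.
have closed_case K : closed K -> K `<=` V ->
    kappa%:E * lambda K <= lambda (Q `&` F @^-1` K).
  move=> cK KV; have mK := rV_closed_measurable cK.
  pose N n := thickening K n.+1%:R^-1.
  pose G n := Q `&` F @^-1` N n.
  have capG : \bigcap_n G n = Q `&` F @^-1` K.
    apply/seteqP; split=> u.
      move=> Gu; split; first by have [] := Gu 0%N I.
      rewrite /= -(bigcap_thickening cK) => n _; exact: (Gu n I).2.
    move=> [Qu Ku] n _; split=> //=; move: Ku.
    by rewrite /= -{1}(bigcap_thickening cK); exact.
  have : lambda \o G @ \oo --> lambda (\bigcap_n G n).
    apply: nonincreasing_cvg_mu => //.
    - apply: le_lt_trans Qfin; apply: le_measure; rewrite ?inE//.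
        by apply: mFpre; apply: mx_open_measurable; exact: thickening_open.
      by move=> u [].
    - by move=> n; apply: mFpre; apply: mx_open_measurable; exact: thickening_open.
    - by rewrite capG; exact: mFpre.
    move=> m n mn; apply/subsetPset => u [Qu [z Kz zu]]; split=> //; exists z => //.
    by apply: le_ball zu; rewrite lef_pV2 ?posrE// ler_nat.
  rewrite capG leNgt => lG; apply/negP => /(cvge_lt_exists lG)[n]/=.
  rewrite ltNge => /negP; apply; apply: closed_comparison => //.
  move=> z Kz; apply: VQ; first exact: KV.
  by rewrite invr_gt0 ltr0n/= invf_le1 ?ler1n ?ltr0n.
apply/lee_addgt0Pr => e e0.
pose nu := mrestr lambda mV.
have [||K [cK KA lAK]] := @closed_inner_regular R d nu _ A (e / kappa) mA.
- by rewrite /nu /= /mrestr setTI.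
- by rewrite divr_gt0.
have mK := rV_closed_measurable cK.
have KV := subset_trans KA AV.
rewrite /nu /= /mrestr (setIidl AV) (setIidl KV) in lAK.
apply: (@le_trans _ _ (kappa%:E * (lambda K + (e / kappa)%:E))).
  by rewrite lee_pmul2l.
rewrite muleDr//; last first.
  by rewrite fin_num_adde_defl.
rewrite -EFinM mulrCA divff ?gt_eqF// mulr1 leeD2r//.
apply: le_trans (closed_case K cK KV) _.
by apply: le_measure; rewrite ?inE; [exact: mFpre|exact: mFpre|move=> u [? /KA ?]].
Qed.

End comparison.

Local Close Scope ereal_scope.

(** If [F u = z] then [F] maps the ball of radius [s / L] around [u] into the ball of
    radius [s] around [z]; the bound [r^-1 <= L] keeps the first ball inside the
    domain for every [s <= 1]. *)
Lemma lipschitz_onto_measure (R : realType) d (F : 'rV[R]_d -> 'rV[R]_d) u0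
    (r L : R) (V A : set 'rV[R]_d) : measurable_fun setT F -> 0 < r -> 0 < L ->
  r^-1 <= L ->
  (forall u v, `|u - u0| < 2 * r -> `|v - u0| < 2 * r -> `|F v - F u| <= L * `|v - u|) ->
  measurable V -> (lebesgue_rV R d V < +oo)%E ->
  (forall y, V y -> exists2 u, `|u - u0| <= r & F u = y) ->
  measurable A -> A `<=` V ->
  ((L^-1 ^+ d)%:E * lebesgue_rV R d A <=
    lebesgue_rV R d (ball u0 (2 * r)%R `&` F @^-1` A))%E.
Proof.
move=> mF r0 L0 rL FL mV Vfin FV mA AV.
have r20 : 0 < 2 * r by rewrite mulr_gt0.
have mQ := measurable_rV_ball u0 (2 * r).
apply: (measurable_comparison mF mQ _ _ Vfin mV mA AV).
- by rewrite lebesgue_rV_ball ?ltry.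
- by rewrite exprn_gt0// invr_gt0.
move=> z s Vz /andP[s0 s1]; have [u ur <-] := FV z Vz.
have sL : 0 < s / L by rewrite divr_gt0.
have sLr : s / L <= r.
  rewrite ler_pdivrMr// (le_trans s1)//.
  by rewrite -(divff (lt0r_neq0 r0)) ler_pM2l.
rewrite lebesgue_rV_ball// -EFinM -exprMn mulrnAr [L^-1 * s]mulrC.
rewrite -(lebesgue_rV_ball u sL); apply: le_measure; rewrite ?inE.
- exact: measurable_rV_ball.
- apply: measurableI => //; rewrite -[X in measurable X]setTI; apply: mF => //.
  exact: measurable_rV_ball.
have uu0 : `|u - u0| < 2 * r by rewrite (le_lt_trans ur)// ltr_pMl// ltr1n.
move=> v /mem_ballP uv.
have vu0 : `|v - u0| < 2 * r.
  rewrite -(subrKA u) (le_lt_trans (ler_normD _ _))// mulrDl mul1r ltr_leD//.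
  by rewrite distrC (lt_le_trans uv).
split; first by apply/mem_ballP; rewrite distrC.
apply/mem_ballP; apply: le_lt_trans (FL _ _ vu0 uu0) _.
by rewrite mulrC -ltr_pdivlMr.
Qed.

(** With [E] completing [D] to an invertible matrix, the maps
    [t |-> (G x t, t *m E)] are uniformly Lipschitz and cover a common ball around
    [(y0, u0 *m E)]; the extra coordinates contribute a constant factor by the
    product formula.  The times are taken near a point [u0] with positive
    coordinates, small enough for the strict derivative at 0 to control them. *)
Lemma strict_derivative_minorization (R : realType) (V : normedModType R) d N
    (G : V -> 'rV[R]_d -> 'rV[R]_N) x0 D (eps : R) :
  strict_derivative_at0 G x0 D -> \rank D = N ->
  (forall x, measurable_fun setT (G x)) -> 0 < eps ->
  exists (y0 : 'rV[R]_N) (kappa rho delta : R),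
    [/\ 0 < kappa, 0 < rho, 0 < delta & forall x (A : set 'rV[R]_N),
      `|x - x0| < delta -> measurable A -> A `<=` ball y0 rho ->
      (kappa%:E * lebesgue_rV R N A <=
       lebesgue_rV R d [set t : 'rV[R]_d | (forall j, 0 <= t 0%R j <= eps)%R /\ A (G x t)])%E].
Proof.
move=> [Gc GD] rD mG eps0.
have [p [E [dNp fP]]] := row_free_completion rD.
move: G D Gc GD rD mG E fP; rewrite {}dNp => {d} G D Gc GD rD mG E fP.
pose P := row_mx D E.
have Pu : P \in unitmx by rewrite -row_free_unit.
pose c := (N + p)%:R * `|invmx P| + 1.
have c0 : 0 < c by rewrite ltr_wpDl// mulr_ge0.
have cP (w : 'rV[R]_(N + p)) : `|w *m invmx P| <= c * `|w|.
  by rewrite (le_trans (mulmx_norm_le _ _))// ler_wpM2r// lerDl.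
(* The factor 32 leaves room, in the contraction, for the variation of [G x u0]
   with the parameter [x]: it is at most [rho], while [local_surjection] covers
   radius [2 * rho]. *)
pose e := (32 * c)^-1; have e0 : 0 < e by rewrite invr_gt0 mulr_gt0.
have [q q0 GDq] := GD e e0.
(* The box of radius [2 * r] around [u0 = (h, ..., h)] has all its coordinates
   between [h / 2] and [3 * h / 2]. *)
pose h := Num.min q eps / 2.
have h0 : 0 < h by rewrite divr_gt0// lt_min q0.
have hq : 2 * h <= q by rewrite mulrC divfK ?gt_eqF// ge_min lexx.
have heps : 2 * h <= eps by rewrite mulrC divfK ?gt_eqF// ge_min lexx orbT.
pose u0 : 'rV[R]_(N + p) := const_mx h.
have u0h : `|u0| <= h by apply: rV_norm_le => [|j]; [exact: ltW|rewrite mxE gtr0_norm].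
pose r := h / 4; have r0 : 0 < r by rewrite divr_gt0.
have uq u : `|u - u0| < 2 * r -> `|u| < q.
  move=> uu0; rewrite -(subrK u0 u) (le_lt_trans (ler_normD _ _))//.
  by rewrite (lt_le_trans _ hq)// (lt_le_trans (ltr_leD uu0 u0h))// /r; lra.
pose rho := h / (16 * c); have rho0 : 0 < rho by rewrite divr_gt0// mulr_gt0.
have [|q' q'0 Gq'] := Gc (rho / 2); first by rewrite divr_gt0.
(* The centre is the linear prediction, as [G] need not be continuous in [x]
   at the time [u0]. *)
pose y0 := G x0 0 + u0 *m D.
pose F x u := row_mx (G x u) (u *m E).
have FD x u v : `|x - x0| < q -> `|u| < q -> `|v| < q ->
    `|F x v - F x u - (v - u) *m P| <= e * `|v - u|.
  move=> xq ur vr; apply: rV_norm_le => [|j]; first by rewrite mulr_ge0// ltW.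
  rewrite /F /P mul_mx_row opp_row_mx add_row_mx opp_row_mx add_row_mx.
  rewrite -mulmxBl subrr; case: (splitP j) => k jk.
    have -> : j = lshift p k by exact: val_inj.
    by rewrite row_mxEl (le_trans (rV_coord_le _ _))// GDq.
  have -> : j = rshift N k by exact: val_inj.
  by rewrite row_mxEr mxE normr0 mulr_ge0// ltW.
have mF x : measurable_fun setT (F x).
  apply: mx_measurable_funP => i j; rewrite ord1.
  case: (splitP j) => k jk.
    have -> : j = lshift p k by exact: val_inj.
    rewrite (_ : (fun _ => _) = (fun u => G x u 0 k)).
      exact: (measurableT_comp (mx_measurable_coord 0 k) (mG x)).
    by apply/funext => u; rewrite row_mxEl.
  have -> : j = rshift N k by exact: val_inj.
  rewrite (_ : (fun _ => _) = (fun u : 'rV[R]_(N + p) => \sum_l u 0 l * E l k)).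
    apply: measurable_sum => l; apply: measurable_funM => //.
    exact: mx_measurable_coord.
  by apply/funext => u; rewrite row_mxEr mxE.
pose z0 := row_mx y0 (u0 *m E).
pose L := (N + p)%:R * `|P| + e + r^-1.
have L0 : 0 < L by rewrite ltr_wpDl ?invr_gt0// addr_ge0 ?mulr_ge0// ltW.
pose W : set 'rV[R]_(N + p) :=
  [set w | ball y0 rho (lsubmx w) /\ ball (u0 *m E) rho (rsubmx w)].
exists y0, (L^-1 ^+ (N + p) * (rho *+ 2) ^+ p), rho, (Num.min q q').
split=> //; first by rewrite mulr_gt0 ?exprn_gt0 ?invr_gt0// mulrn_wgt0.
  by rewrite lt_min q0.
move=> x A; rewrite lt_min => /andP[xq xq'] mA Ay0.
have lW (B : set 'rV[R]_N) : measurable B -> lebesgue_rV R (N + p)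
    [set w | B (lsubmx w) /\ ball (u0 *m E) rho (rsubmx w)] =
    (lebesgue_rV R N B * ((rho *+ 2) ^+ p)%:E)%E.
  move=> mB; rewrite lebesgue_rV_product//; last exact: measurable_rV_ball.
  by rewrite lebesgue_rV_ball.
have mW (B : set 'rV[R]_N) : measurable B -> measurable
    [set w : 'rV[R]_(N + p) | B (lsubmx w) /\ ball (u0 *m E) rho (rsubmx w)].
  move=> mB; apply: measurableI.
    by rewrite -[X in measurable X]setTI; exact: measurable_lsubmx.
  rewrite -[X in measurable X]setTI; apply: measurable_rsubmx => //.
  exact: measurable_rV_ball.
pose B := [set w : 'rV[R]_(N + p) | A (lsubmx w) /\ ball (u0 *m E) rho (rsubmx w)].
have Gy0 : `|G x u0 - y0| <= rho.
  have -> : G x u0 - y0 = (G x u0 - G x 0 - (u0 - 0) *m D) + (G x 0 - G x0 0).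
    by rewrite /y0 subr0; apply/rowP => j; rewrite !mxE; ring.
  rewrite (splitr rho) (le_trans (ler_normD _ _))// lerD//; last first.
    by rewrite ltW// Gq' ?normr0.
  apply: le_trans (GDq _ _ _ _ _ _) _ => //; rewrite ?normr0//.
    by apply: uq; rewrite subrr normr0 mulr_gt0.
  rewrite subr0 (le_trans (ler_wpM2l (ltW e0) u0h))// le_eqVlt; apply/orP; left.
  by apply/eqP; rewrite /e /rho; field; rewrite gt_eqF.
have onto y : W y -> exists2 u, `|u - u0| <= r & F x u = y.
  move=> [/mem_ballP y1 /mem_ballP y2].
  apply: (@local_surjection _ _ (F x) P u0 r c e) => //.
  - by rewrite /e invfM mulrCA divff ?gt_eqF// mulr1 lef_pV2 ?posrE// ler_nat.
  - have rr : r < 2 * r by rewrite ltr_pMl// ltr1n.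
    by move=> u v ur vr; apply: FD => //; apply: uq; exact: le_lt_trans rr.
  have -> : r / (2 * c) = rho + rho.
    by rewrite /r /rho; field; rewrite gt_eqF.
  apply: rV_norm_le => [|j]; first by rewrite addr_ge0// ltW.
  rewrite !mxE; case: (splitP j) => k jk.
    have -> : j = lshift p k by exact: val_inj.
    have -> : y 0 (lshift p k) - G x u0 0 k =
        (lsubmx y - y0) 0 k - (G x u0 - y0) 0 k by rewrite !mxE; ring.
    rewrite (le_trans (ler_normB _ _))// lerD//.
      by rewrite (le_trans (rV_coord_le _ _))// distrC ltW.
    by rewrite (le_trans (rV_coord_le _ _)).
  have -> : j = rshift N k by exact: val_inj.
  have -> : y 0 (rshift N k) - (u0 *m E) 0 k = (rsubmx y - u0 *m E) 0 k.
    by rewrite !mxE.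
  by rewrite (le_trans (rV_coord_le _ _))// distrC (le_trans (ltW y2))// lerDl ltW.
have Wfin : (lebesgue_rV R (N + p) W < +oo)%E.
  by rewrite lW ?lebesgue_rV_ball// -?EFinM ?ltry//; exact: measurable_rV_ball.
have mainle := @lipschitz_onto_measure R (N + p) (F x) u0 r L W B (mF x) r0 L0.
apply: (@le_trans _ _ (lebesgue_rV R (N + p) (ball u0 (2 * r) `&` F x @^-1` B))%R).
  apply: le_trans (mainle _ _ _ Wfin onto _ _).
  - by rewrite lW// EFinM -!muleA; rewrite (muleC (lebesgue_rV R N A)).
  - by rewrite lerDr addr_ge0 ?mulr_ge0// ltW.
  - move=> u v ur vr; rewrite -[F x v - F x u](subrK ((v - u) *m P)).
    apply: le_trans (ler_normD _ _) _; rewrite addrC /L 2!mulrDl.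
    apply: ler_wpDr; first by rewrite mulr_ge0// invr_ge0 ltW.
    by apply: lerD; [exact: mulmx_norm_le|apply: FD => //; exact: uq].
  - by apply: mW; exact: measurable_rV_ball.
  - exact: mW.
  - by move=> w [/Ay0 ? ?].
have mFB : measurable (F x @^-1` B).
  by rewrite -[X in measurable X]setTI; apply: mF => //; exact: mW.
apply: le_measure; rewrite ?inE.
- by apply: measurableI => //; exact: measurable_rV_ball.
- apply: measurableI; last by rewrite -[X in measurable X]setTI; exact: mG.
  rewrite (_ : (fun _ => _) = \bigcap_(j in [set: 'I_(N + p)])
      ((fun u : 'rV[R]_(N + p) => u 0 j) @^-1` `[0, eps])).
    apply: fin_bigcap_measurable => // j _; rewrite -[X in measurable X]setTI.
    exact: mx_measurable_coord.
  by apply/seteqP; split=> t /= tj j => [_|]; have := tj j; rewrite /= in_itv//=; exact.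
move=> t [/mem_ballP tu0 [At _]]; split=> [j|]; last first.
  by move: At; rewrite /= /F row_mxKl.
have := rV_coord_le (u0 - t) j; rewrite !mxE => /le_lt_trans /(_ tu0).
by rewrite ltr_norml /r => /andP[? ?]; apply/andP; split; lra.
Qed.

(** * Iterated jump kernel *)

Section kernel.
Context {R : realType} {N : nat}.
Variables (b : 'rV[R]_N -> 'rV[R]_N) (a : 'I_N -> 'rV[R]_N -> 'rV[R]_N).
Variables (f : 'I_N -> 'rV[R]_N -> R) (gamma : R -> 'rV[R]_N -> 'rV[R]_N).
Hypotheses (hgamma : is_flow b gamma) (hb : lipschitz b).
Hypotheses (ca : forall i, continuous (a i)) (cf : forall i, continuous (f i)).
Hypothesis f0 : forall i x, 0 < f i x.

Lemma fbar_continuous : continuous (fbar f).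
Proof. exact: continuous_sum. Qed.

Lemma fbar_gt0 (i : 'I_N) x : 0 < fbar f x.
Proof.
rewrite /fbar (bigD1 i)//= ltr_wpDr// sumr_ge0// => j _; exact: ltW.
Qed.

Lemma fbar_ge0 x : 0 <= fbar f x.
Proof. by rewrite sumr_ge0// => j _; exact: ltW. Qed.

Lemma jump_kernel_ge0 (g : 'rV[R]_N -> \bar R) : (forall x, 0 <= g x)%E ->
  forall x, (0 <= jump_kernel a f gamma g x)%E.
Proof.
move=> g0 x; apply: sume_ge0 => i _; apply: mule_ge0.
  by rewrite lee_fin divr_ge0// ?fbar_ge0 ?ltW.
apply: integral_ge0 => t _; apply: mule_ge0 => //.
by rewrite lee_fin mulr_ge0 ?expR_ge0 ?fbar_ge0.
Qed.

Lemma jump_kernel_iter_ge0 k x A : (0 <= jump_kernel_iter a f gamma k x A)%E.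
Proof.
rewrite /jump_kernel_iter; elim: k x => [|k IH] x /=; first by rewrite lee_fin.
exact: jump_kernel_ge0.
Qed.

Lemma jump_continuous i : continuous (jump a i).
Proof. by move=> x; apply: continuousD; [exact: cvg_id|exact: ca]. Qed.

Lemma survival_ge y (s m : R) : 0 <= s <= 1 -> 0 <= m ->
  (forall u, 0 <= u <= s -> fbar f (gamma u y) <= m) ->
  expR (- m) <= survival f gamma y s.
Proof.
move=> /andP[s0 s1] m0 fm; rewrite /survival ler_expR lerN2.
have cg : continuous (fun u => fbar f (gamma u y)).
  move=> u; apply: (@continuous_comp _ _ _ (fun u => gamma u y) (fbar f)).
    exact: hgamma.1.
  exact: fbar_continuous.
apply: (@le_trans _ _ (\int[lebesgue_measure]_(u in `[0, s]) m)).
  apply: le_Rintegral => //.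
  - apply: continuous_compact_integrable; first exact: segment_compact.
    exact: continuous_subspaceT.
  - apply: continuous_compact_integrable; first exact: segment_compact.
    by apply: continuous_subspaceT => u; exact: cst_continuous.
rewrite Rintegral_cst//= lebesgue_measure_itv/= lte_fin.
by case: ifP => _; rewrite /= ?subr0 ?mulr0// ler_piMr.
Qed.

(** The lower bound for one jump.  The dominated function is allowed to be a mere
    minorant [g] of [h] along the trajectory, so that only [g] has to be
    measurable; the first conclusion keeps the next starting point near [jump a j xs]. *)
Lemma jump_kernel_ge j xs (d e : R) : 0 < d -> 0 < e ->
  exists c eps delta : R, [/\ 0 < c, 0 < eps <= e, 0 < delta &
    forall x, `|x - xs| < delta ->
      (forall s, 0 <= s <= eps -> `|gamma s (jump a j x) - jump a j xs| < d) /\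
      forall (h : 'rV[R]_N -> \bar R) (g : R -> \bar R),
        (forall y, 0 <= h y)%E -> (forall s, 0 <= g s)%E -> measurable_fun setT g ->
        (forall s, 0 <= s <= eps -> (g s <= h (gamma s (jump a j x)))%E) ->
        (c%:E * \int[lebesgue_measure]_(s in `[0%R, eps]) g s
          <= jump_kernel a f gamma h x)%E].
Proof.
move=> d0 e0; pose ys := jump a j xs; pose m := fbar f ys.
have m0 : 0 < m by exact: fbar_gt0.
have m20 : 0 < m / 2 by rewrite divr_gt0.
have [r r0 rP] := continuous_dist_lt ys fbar_continuous m20.
have [r1 r10 r1P] : exists2 r1 : R, 0 < r1 & forall s y, `|s - 0| < r1 ->
    `|y - ys| < r1 -> `|gamma s y - ys| < Num.min r d.
  have rd0 : 0 < Num.min r d by rewrite lt_min r0.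
  have := flow_near hgamma hb 0 ys rd0; rewrite (flow0 hgamma); exact.
have [r2 r20 r2P] := continuous_dist_lt xs (@jump_continuous j) r10.
pose p := f j xs / fbar f xs.
have p0 : 0 < p by rewrite divr_gt0// (fbar_gt0 j).
have cp : continuous (fun x => f j x / fbar f x).
  apply: continuous_div; [exact: cf|exact: fbar_continuous|].
  by move=> x; rewrite gt_eqF// (fbar_gt0 j).
have p20 : 0 < p / 2 by rewrite divr_gt0.
have [r3 r30 r3P] := continuous_dist_lt xs cp p20.

pose c1 := expR (- (2 * m)) * (m / 2).
have c10 : 0 < c1 by rewrite mulr_gt0 ?expR_gt0.
exists (p / 2 * c1), (Num.min (Num.min 1 e) (r1 / 2)), (Num.min r2 r3).
split; first by rewrite mulr_gt0.
- by rewrite !lt_min ltr01 e0 divr_gt0//= ge_min ge_min lexx orbT.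
- by rewrite lt_min r20.
move=> x; rewrite lt_min => /andP[x2 x3]; set y := jump a j x.
have yr1 : `|y - ys| < r1 by exact: r2P.
have near_y s : 0 <= s <= Num.min (Num.min 1 e) (r1 / 2) ->
    s <= 1 /\ `|gamma s y - ys| < Num.min r d.
  rewrite !le_min => /and3P[s0 /andP[s1 _] sr]; split => //; apply: r1P => //.
  by rewrite subr0 ger0_norm// (le_lt_trans sr)// ltr_pdivrMr// ltr_pMr// ltr1n.
split=> [s /near_y[_]|h g h0 g0 mg gh]; first by rewrite lt_min => /andP[].
have fbar_near s : 0 <= s <= Num.min (Num.min 1 e) (r1 / 2) ->
    m / 2 <= fbar f (gamma s y) <= 2 * m.
  move=> /near_y[_]; rewrite lt_min => /andP[/rP]; rewrite ltr_norml -/m => /andP[? ?] _.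
  by apply/andP; split; lra.
have pp : p / 2 <= f j x / fbar f x.
  by have := r3P x x3; rewrite -/p ltr_norml => /andP[? _]; lra.
pose I i : \bar R := (\int[lebesgue_measure]_(t in `[0%R, +oo[)
      ((survival f gamma (jump a i x) t * fbar f (gamma t (jump a i x)))%:E
        * h (gamma t (jump a i x))))%E.
have I0 i : (0 <= I i)%E.
  apply: integral_ge0 => t _; apply: mule_ge0 => //.
  by rewrite lee_fin mulr_ge0 ?expR_ge0 ?fbar_ge0.
apply: (@le_trans _ _ ((f j x / fbar f x)%:E * I j)%E); last first.
  rewrite /jump_kernel (bigD1 j)//= leeDl//; apply: sume_ge0 => i _.
  by apply: mule_ge0; [rewrite lee_fin divr_ge0// ?fbar_ge0 ?ltW|exact: I0].
rewrite EFinM -muleA; apply: lee_pmul => //.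
- by rewrite lee_fin divr_ge0// ltW.
- by rewrite mule_ge0 ?lee_fin ?(ltW c10)// integral_ge0.
rewrite -ge0_integralZl//; last 2 first.
- exact: measurable_funS mg.
- by rewrite lee_fin ltW.
apply: le_integral_ge0 => [s _|s _||s].
- by rewrite mule_ge0// lee_fin ltW.
- by rewrite mule_ge0// lee_fin mulr_ge0 ?expR_ge0 ?fbar_ge0.
- by apply: subset_itvl; rewrite bnd_simp.
rewrite /= in_itv/= => sI; apply: lee_pmul => //; [by rewrite lee_fin ltW| |exact: gh].
rewrite lee_fin; apply: ler_pM; [exact: expR_ge0|exact: ltW| |by have /andP[] := fbar_near _ sI].
apply: survival_ge => [||u /andP[u0 us]].
- by have [-> _] := near_y _ sI; have /andP[->] := sI.
- by rewrite mulr_ge0// ltW.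
have : 0 <= u <= Num.min (Num.min 1 e) (r1 / 2).
  by rewrite u0 (le_trans us)//; have /andP[] := sI.
by move=> /fbar_near/andP[].
Qed.

End kernel.

Section jump_flow.
Context {R : realType} {N : nat}.
Variables (b : 'rV[R]_N -> 'rV[R]_N) (a : 'I_N -> 'rV[R]_N -> 'rV[R]_N).
Variables (f : 'I_N -> 'rV[R]_N -> R) (gamma : R -> 'rV[R]_N -> 'rV[R]_N).
Hypotheses (hgamma : is_flow b gamma) (hb : lipschitz b).
Hypotheses (ca : forall i, continuous (a i)) (cf : forall i, continuous (f i)).
Hypothesis f0 : forall i x, 0 < f i x.

Definition rV_behead n (t : 'rV[R]_n.+1) : 'rV[R]_n := \row_j t 0 (lift ord0 j).

Lemma rV_behead_cons n s (t : 'rV[R]_n) : rV_behead (rV_cons (s, t)) = t.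
Proof. by apply/rowP => j; rewrite mxE rV_consS. Qed.

(** Peeling off the first jump matches the recursive structure of the iterated
    kernel and of [lebesgue_rV], whereas [final_state] recurses on the last jump. *)
Fixpoint jump_flow k : ('I_k -> 'I_N) -> 'rV[R]_N -> 'rV[R]_k -> 'rV[R]_N :=
  match k with
  | 0 => fun _ x _ => x
  | k'.+1 => fun i x t =>
      jump_flow (i \o lift ord0) (gamma (t 0 ord0) (jump a (i ord0) x)) (rV_behead t)
  end.

Lemma post_jump_behead n (i : 'I_n.+2 -> 'I_N) x t k : (k <= n)%N ->
  post_jump a gamma i x t k.+1 =
  post_jump a gamma (i \o lift ord0)
    (jump a (i (lift ord0 ord0)) (gamma (t 0 ord0) x)) (rV_behead t) k.
Proof.
have lE l : (l < n.+1)%N -> inord l.+1 = lift ord0 (inord l) :> 'I_n.+2.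
  by move=> ln; apply/val_inj; rewrite /= !inordK.
elim: k => [_|k IH kn].
  have -> : lift ord0 ord0 = inord 1 :> 'I_n.+2 by apply/val_inj; rewrite /= inordK.
  have -> : ord0 = inord 0 :> 'I_n.+2 by apply/val_inj; rewrite /= inordK.
  by [].
have -> : post_jump a gamma i x t k.+2 = jump a (i (inord k.+2))
  (gamma (t 0 (inord k.+1)) (post_jump a gamma i x t k.+1)) by [].
by rewrite IH ?(ltnW kn)// lE// lE ?ltnS ?(ltnW kn)//= mxE.
Qed.

Lemma jump_flow_final_state n (i : 'I_n.+1 -> 'I_N) x t :
  jump_flow i x t = final_state a gamma i (jump a (i ord0) x) t.
Proof.
elim: n i x t => [|n IH] i x t.
  rewrite /= /final_state /=; congr (gamma (t _ _) _); exact/val_inj.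
rewrite -[LHS]/(jump_flow (i \o lift ord0) (gamma (t 0 ord0) (jump a (i ord0) x)) (rV_behead t)).
rewrite IH /final_state post_jump_behead//; congr (gamma _ _); rewrite mxE.
by congr (t _ _); exact/val_inj.
Qed.

(** Over an arbitrary source, so that it applies to the successive positions as
    functions of the jump times. *)
Lemma flow_continuous2 (T : topologicalType) (s : T -> R) (g : T -> 'rV[R]_N) :
  continuous s -> continuous g -> continuous (fun x => gamma (s x) (g x)).
Proof.
move=> cs cg x; apply/cvgrPdist_lt => e e0.
have [r r0 rP] := flow_near hgamma hb (s x) (g x) e0.
near=> y; rewrite distrC; apply: rP; rewrite distrC; near: y.
  by have /cvgrPdist_lt := cs x; exact.
by have /cvgrPdist_lt := cg x; exact.
Unshelve. all: by end_near. Qed.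

Lemma post_jump_continuous n (i : 'I_n.+1 -> 'I_N) x k :
  continuous (fun t => post_jump a gamma i x t k).
Proof.
elim: k => [|k IH]; first by move=> t; exact: cst_continuous.
have cj := flow_continuous2 (@coord_continuous _ _ _ 0 (inord k)) IH.
by move=> t; apply: (continuous_comp (cj t)); exact: jump_continuous.
Qed.

Lemma final_state_measurable n (i : 'I_n.+1 -> 'I_N) x :
  measurable_fun setT (final_state a gamma i x).
Proof.
have cF : continuous (final_state a gamma i x) :=
  flow_continuous2 (@coord_continuous _ _ _ 0 ord_max) (@post_jump_continuous n i x n).
apply: (measurability (@open 'rV[R]_N)) => // _ [U oU <-].
by rewrite setTI; apply: mx_open_measurable; apply: open_comp.
Qed.

Lemma jump_flow_measurable k (i : 'I_k -> 'I_N) x :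
  measurable_fun setT (jump_flow i x).
Proof.
case: k i => [|n] i; first exact: measurable_cst.
rewrite (_ : jump_flow i x = final_state a gamma i (jump a (i ord0) x)).
  exact: final_state_measurable.
by apply/funext => t; exact: jump_flow_final_state.
Qed.

Definition short_times k (i : 'I_k -> 'I_N) x (e : R) (A : set 'rV[R]_N) : set 'rV[R]_k :=
  [set t : 'rV[R]_k | (forall j, 0 <= t 0 j <= e) /\ A (jump_flow i x t)].

Lemma short_times_measurable k (i : 'I_k -> 'I_N) x e A :
  measurable A -> measurable (short_times i x e A).
Proof.
move=> mA; apply: measurableI; last first.
  by rewrite -[X in measurable X]setTI; exact: jump_flow_measurable.
rewrite (_ : (fun _ => _) = \bigcap_(j in [set: 'I_k])
    ((fun u : 'rV[R]_k => u 0 j) @^-1` `[0, e])).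
  apply: fin_bigcap_measurable => // j _; rewrite -[X in measurable X]setTI.
  exact: mx_measurable_coord.
by apply/seteqP; split=> t /= tj j => [_|]; have := tj j; rewrite /= in_itv//=; exact.
Qed.

(** Induction on the number of jumps: the section of the set of short times at the
    first time is the set of short times from the position reached at that time, so
    the integral in the one-jump bound rebuilds Lebesgue measure in one more
    dimension. *)
Lemma jump_kernel_iter_ge k (i : 'I_k -> 'I_N) xs :
  exists c e delta : R, [/\ 0 < c, 0 < e, 0 < delta &
    forall x A, `|x - xs| < delta -> measurable A ->
      (c%:E * lebesgue_rV R k (short_times i x e A)
        <= jump_kernel_iter a f gamma k x A)%E].
Proof.
elim: k i xs => [|k IH] i xs.
  exists 1, 1, 1; split=> // x A _ mA; rewrite mul1e /jump_kernel_iter /=.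
  rewrite diracE lee_fin indicE; have [/set_mem [_ /= Ax]|//] := boolP (_ \in _).
  by rewrite mem_set.
pose i' := i \o lift ord0; pose ys := jump a (i ord0) xs.
have [c [e [d [c0 e0 d0 cP]]]] := IH i' ys.
have [c' [e' [d' [c'0 /andP[e'0 e'e] d'0 c'P]]]] :=
  jump_kernel_ge hgamma hb ca cf f0 (i ord0) xs d0 e0.
exists (c' * c), e', d'; split=> //; first exact: mulr_gt0.
move=> x A xd mA; have [near_x lower] := c'P x xd.
pose S := @rV_cons R k @^-1` short_times i x e' A.
have mS : measurable S.
  rewrite -[X in measurable X]setTI; apply: measurable_rV_cons => //.
  exact: short_times_measurable.
pose g s : \bar R := (c%:E * lebesgue_rV R k (xsection S s))%E.
have SE s t : xsection S s t <-> 0 <= s <= e' /\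
    short_times i' (gamma s (jump a (i ord0) x)) e' A t.
  rewrite /xsection /= inE /S /= /short_times /= rV_behead_cons.
  have -> : rV_cons (s, t) 0 ord0 = s by exact: rV_cons0.
  split=> [[bx At]|[s0 [bx At]]].
    split; first by have := bx ord0; rewrite [rV_cons _ _ _]rV_cons0.
    by split=> // j; have := bx (lift ord0 j); rewrite rV_consS.
  split=> // j; case: (unliftP ord0 j) => [l ->|->]; first by rewrite rV_consS.
  by rewrite [rV_cons _ _ _]rV_cons0.
have g0 s : (0 <= g s)%E by rewrite mule_ge0 ?lee_fin ?(ltW c0)// measure_ge0.
have mg : measurable_fun setT g.
  by apply: measurable_funeM; exact: measurable_fun_xsection.
rewrite -[jump_kernel_iter _ _ _ _ _ _]/(jump_kernel a f gamma
  (fun y => jump_kernel_iter a f gamma k y A) x).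
have h0 y : (0 <= jump_kernel_iter a f gamma k y A)%E by exact: jump_kernel_iter_ge0.
apply: le_trans (lower _ g h0 g0 mg _).
  rewrite EFinM -muleA; apply: lee_pmul => //; first by rewrite lee_fin ltW.
    by rewrite mule_ge0 ?lee_fin ?(ltW c0)// measure_ge0.
  rewrite integral_mkcond (_ : g \_ _ = g); last first.
    apply/funext => s; rewrite patchE; case: ifPn => // /negP sI.
    rewrite /g (_ : xsection S s = set0) ?measure0 ?mule0//.
    rewrite -subset0 => t /SE [s0 _]; apply: sI; rewrite inE /=.
    by rewrite in_itv.
  rewrite /g ge0_integralZl//; first exact: measurable_fun_xsection.
  by rewrite lee_fin ltW.
move=> s sI; apply: le_trans (cP _ _ (near_x s sI) mA).
rewrite lee_pmul2l//; apply: le_measure; rewrite ?inE.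
- exact: measurable_xsection.
- exact: short_times_measurable.
move=> t /SE [_ [bt At]]; split=> // j.
by have /andP[-> tj] := bt j; exact: le_trans e'e.
Qed.

End jump_flow.

(** * Smooth compactly supported densities *)

Section bump.
Context {R : realType}.
Implicit Types (k : nat) (p : {poly R}) (s : R).

(** The family [p (s) * (1 - s ^+ 2) ^- k * exp (- (1 - s ^+ 2)^-1)] is stable under
    differentiation, which makes all iterated derivatives explicit. *)
Definition bump_core k p s : R :=
  p.[s] * ((1 - s ^+ 2)^-1 ^+ k * expR (- (1 - s ^+ 2)^-1)).

Definition bump k p s : R := if `|s| < 1 then bump_core k p s else 0.

Definition bump_deriv k p : {poly R} :=
  p^`() * (1 - 'X^2) ^+ 2 + (2 * k%:R)%:P * 'X * p * (1 - 'X^2) - 2%:P * 'X * p.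

Lemma one_minus_sqr_gt0 s : `|s| < 1 -> 0 < 1 - s ^+ 2.
Proof. by move=> s1; rewrite subr_gt0 -real_normK ?num_real// expr_lt1. Qed.

Lemma bump_core_derive k p s : `|s| < 1 ->
  is_derive s (1 : R) (bump_core k p) (bump_core k.+2 (bump_deriv k p) s).
Proof.
move=> s1; pose w s : R := 1 - s ^+ 2; pose v s := (w s)^-1.
have w0 : w s != 0.
  by rewrite gt_eqF// one_minus_sqr_gt0.
have dw : is_derive s (1 : R) w (- (2 * s)).
  apply: (is_derive_ext
    (is_deriveB (is_derive_cst (1:R) s (1:R)) (is_deriveX 2 (is_derive_id s (1:R))))) => //.
  by rewrite sub0r /= expr1 /GRing.scale /= mulr1.
have dv : is_derive s (1 : R) v ((2 * s) * (v s) ^+ 2).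
  apply: (is_derive_ext (is_deriveV w0 dw)) => //.
  by rewrite /GRing.scale /= mulrNN mulrC exprVn.
have dE : is_derive s (1 : R) (fun u => expR (- v u)) (- (2 * s * (v s) ^+ 2) * expR (- v s)).
  have := @is_derive1_comp _ expR (- v) s _ _ (is_derive_expR (- v s)) (is_deriveN dv).
  move/is_derive_ext; apply => //.
  by rewrite mulrC.
have dp := is_derive_poly p s.
apply: (is_derive_ext (is_deriveM dp (is_deriveM (is_deriveX k dv) dE))) => //.
  by move=> u; rewrite exprfctE.
have sE (x y : R) : x *: y = x * y by [].
have kE : k%:R * v s ^+ k.-1 = k%:R * v s ^+ k * w s.
  by case: (k) => [|l]; rewrite ?mul0r//= exprSr mulrA divfK.
have -> : (v ^+ k * (fun u => expR (- v u))) s = v s ^+ k * expR (- v s).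
  by rewrite exprfctE.
have -> : (v ^+ k) s = v s ^+ k by rewrite exprfctE.
have hq : (bump_deriv k p).[s] =
    p^`().[s] * w s ^+ 2 + 2 * k%:R * s * p.[s] * w s - 2 * s * p.[s].
  by rewrite /bump_deriv /w !(hornerD, hornerN, hornerM, hornerC, hornerX, hornerXn, expr2).
have -> : bump_core k.+2 (bump_deriv k p) s =
   (p^`().[s] * w s ^+ 2 + 2 * k%:R * s * p.[s] * w s - 2 * s * p.[s])
    * (v s ^+ k * v s ^+ 2 * expR (- v s)).
  by rewrite /bump_core hq -/(w s) -/(v s) -(addn2 k) exprD.
rewrite !sE kE; move: (v s ^+ k) (expR _) => V E.
rewrite /v; field.
exact: w0.
Qed.

(** From [exp (u / m) >= u / m] with [m = k + 2] and [u = (1 - s ^+ 2)^-1], the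
    exponential beats [u ^+ m]; the two spare powers of [u] give the square. *)
Lemma bump_core_bound k p s : `|s| < 1 -> `|bump_core k p s| <=
  (\sum_(i < size p) `|p`_i|) * k.+2%:R ^+ k.+2 * (1 - s ^+ 2) ^+ 2.
Proof.
move=> s1; set w := 1 - s ^+ 2; set u := w^-1.
have w0 : 0 < w by exact: one_minus_sqr_gt0.
have u0 : 0 < u by rewrite invr_gt0.
have ps : `|p.[s]| <= \sum_(i < size p) `|p`_i|.
  rewrite horner_coef (le_trans (ler_norm_sum _ _ _))//; apply: ler_sum => i _.
  by rewrite normrM ler_piMr// normrX exprn_ile1// ltW.
have ue : u ^+ k.+2 * expR (- u) <= k.+2%:R ^+ k.+2.
  rewrite expRN ler_pdivrMr ?expR_gt0//.
  have {1}-> : u = k.+2%:R * (u / k.+2%:R) by rewrite mulrCA divff ?mulr1// pnatr_eq0.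
  rewrite exprMn ler_pM2l ?exprn_gt0 ?ltr0n//.
  rewrite -[X in expR X](divfK (_ : k.+2%:R != 0)) ?pnatr_eq0// expRM_natr.
  rewrite lerXn2r ?nnegrE ?expR_ge0 ?divr_ge0 ?(ltW u0)//.
  by rewrite (le_trans _ (expR_ge1Dx _))// lerDr.
rewrite /bump_core -/w -/u normrM -mulrA ler_pM//.
rewrite ger0_norm ?mulr_ge0 ?expR_ge0 ?exprn_ge0 ?(ltW u0)//.
have -> : u ^+ k * expR (- u) = (u ^+ k.+2 * expR (- u)) * w ^+ 2.
  by rewrite -(addn2 k) exprD /u; field; rewrite gt_eqF.
by rewrite ler_wpM2r// exprn_ge0// ltW.
Qed.

(** At the end points the function is quadratically small on one side and zero on
    the other. *)
Lemma bump_flat k p (s0 : R) : `|s0| = 1 -> is_derive s0 (1 : R) (bump k p) 0.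
Proof.
move=> s01; have [C C0 pC] : exists2 C : R, 0 <= C & forall s, `|s| < 1 ->
    `|bump_core k p s| <= C * (1 - s ^+ 2) ^+ 2.
  exists ((\sum_(i < size p) `|p`_i|) * k.+2%:R ^+ k.+2); last exact: bump_core_bound.
  by rewrite mulr_ge0 ?exprn_ge0// sumr_ge0.
have bs0 : bump k p s0 = 0 by rewrite /bump s01 ltxx.
have bC s : `|bump k p s| <= C * 4 * `|s - s0| ^+ 2.
  rewrite /bump; case: ifPn => s1; last by rewrite normr0 !mulr_ge0.
  apply: le_trans (pC _ s1) _; rewrite -mulrA ler_wpM2l//.
  have -> : 4 * `|s - s0| ^+ 2 = (2 * `|s - s0|) ^+ 2 by rewrite exprMn; ring.
  rewrite lerXn2r ?nnegrE ?mulr_ge0//; first exact/ltW/one_minus_sqr_gt0.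
  have -> : 1 - s ^+ 2 = (1 + `|s|) * (1 - `|s|).
    by rewrite -(real_normK (num_real s)); ring.
  apply: ler_pM; [by rewrite addr_ge0|by rewrite subr_ge0 ltW| |].
    by have := ltW s1; lra.
  by rewrite distrC -s01 (le_trans (lerB_dist _ _)).
have cv : h^-1 *: ((bump k p \o shift s0) (h *: (1:R)) - bump k p s0) @[h --> 0^'] --> (0:R).
  apply/cvgr0Pnorm_lt => e e0; near=> h.
  have h0 : h != 0 by near: h; exact: nbhs_dnbhs_neq.
  rewrite bs0 subr0 /= normrZ normfV.
  rewrite -ltr_pdivlMl ?invr_gt0 ?normr_gt0// invrK.
  apply: le_lt_trans (bC _) _; rewrite addrK normrZ normr1 mulr1 expr2 mulrA.
  rewrite mulrC ltr_pM2l ?normr_gt0//.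
  apply: le_lt_trans (_ : (C * 4 + 1) * `|h| < _); first by rewrite ler_wpM2r// lerDl.
  rewrite -ltr_pdivlMl ?ltr_wpDl ?mulr_ge0//.
  near: h; apply: dnbhs0_lt; rewrite mulr_gt0// invr_gt0.
  by rewrite ltr_wpDl ?mulr_ge0.
apply: DeriveDef; first by apply/cvg_ex; exists 0.
exact: cvg_lim cv.
Unshelve. all: by end_near. Qed.

Lemma bump_derive k p s :
  is_derive s (1 : R) (bump k p) (bump k.+2 (bump_deriv k p) s).
Proof.
have cn : continuous (fun s : R => `|s|) by exact: norm_continuous.
have [s1|s1|s1] := ltgtP `|s| 1.
- rewrite /bump s1; apply: near_eq_is_derive (bump_core_derive k p s1).
  near=> u; case: ifPn => // /negP[]; near: u.
  by apply: cvgr_lt s1; exact: cn.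
- rewrite /bump ltNge (ltW s1)/=; apply: near_eq_is_derive (is_derive_cst 0 s 1).
  near=> u; case: ifPn => //; rewrite ltNge => /negP[]; apply/ltW; near: u.
  by apply: cvgr_gt s1; exact: cn.
- rewrite [X in is_derive _ _ _ X](_ : _ = 0); first exact: bump_flat.
  by rewrite /bump s1 ltxx.
Unshelve. all: by end_near. Qed.

End bump.

Section bump_rV.
Context {R : realType} {N : nat}.
Implicit Types (k : 'I_N -> nat) (p : 'I_N -> {poly R}) (y z : 'rV[R]_N).

(** Products of one-variable bumps, with separate parameters for each coordinate: a
    partial derivative changes only those of its own coordinate. *)
Definition bump_rV (C c : R) z k p y : R :=
  C * \prod_j bump (k j) (p j) (c * (y 0 j - z 0 j)).

Lemma bumpZ n (r : R) (q : {poly R}) s : bump n (r *: q) s = r * bump n q s.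
Proof. by rewrite /bump /bump_core hornerZ; case: ifP; rewrite ?mulr0 ?mulrA. Qed.

Lemma bump_rV_derive C c z k p y l : is_derive y (delta_mx 0 l) (bump_rV C c z k p)
  (bump_rV C c z (fun j => if j == l then (k j).+2 else k j)
    (fun j => if j == l then c *: bump_deriv (k j) (p j) else p j) y).
Proof.
apply: is_derive_line.
pose D := \prod_(j | j != l) bump (k j) (p j) (c * (y 0 j - z 0 j)).
pose g h : R := c * (h + y 0 l - z 0 l).
have dg : is_derive (0:R) (1:R) g c.
  apply: (is_derive_ext (is_deriveZ c (is_deriveD (is_derive_id (0:R) (1:R))
    (is_derive_cst (y 0 l - z 0 l) (0:R) (1:R))))).
    by move=> h; rewrite /g -addrA.
  by rewrite addr0; exact: mulr1.
have db := is_derive1_comp (bump_derive (k l) (p l) (g 0)) dg.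
apply: (is_derive_ext (is_deriveZ (C * D) db)) => [h|].
  rewrite /bump_rV (bigD1 l)//= -[LHS]/((C * D) * bump (k l) (p l) (g h)).
  rewrite (_ : \prod_(j | j != l) _ = D).
    by rewrite !mxE !eqxx mulr1 -/(g h); ring.
  apply: eq_bigr => j jl; congr bump.
  by rewrite !mxE /= (negbTE jl) mulr0 add0r.
rewrite /bump_rV (bigD1 l)//= eqxx bumpZ /g add0r.
rewrite -[LHS]/((C * D) * (bump (k l).+2 (bump_deriv (k l) (p l)) (c * (y 0 l - z 0 l)) * c)).
rewrite (_ : \prod_(j | _) _ = D); first by ring.
by apply: eq_bigr => j jl; rewrite (negbTE jl).
Qed.

Lemma bump_continuous n (q : {poly R}) : continuous (bump n q).
Proof.
move=> s; apply: differentiable_continuous; apply/derivable1_diffP.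
by case: (bump_derive n q s).
Qed.

Lemma bump_rV_continuous C c z k p : continuous (bump_rV C c z k p).
Proof.
have cb j : continuous (fun y => bump (k j) (p j) (c * (y 0 j - z 0 j))).
  apply: continuous_compose; last exact: bump_continuous.
  apply: continuous_affine; exact: coord_continuous.
have := @continuous_affine _ _ C 0 _ (continuous_prod cb).
by rewrite (_ : (fun _ => _) = bump_rV C c z k p)//; apply/funext => y; rewrite subr0.
Qed.

Lemma bump_rV_smooth C c z k p : smooth (bump_rV C c z k p).
Proof.
move=> s; have [k' [p' ->]] : exists k' p',
    foldr (@partial R N) (bump_rV C c z k p) s = bump_rV C c z k' p'.
  elim: s => [|l s [k' [p' IH]]] /=; first by exists k, p.
  rewrite IH; eexists; eexists; apply/funext => y; rewrite /partial.
  by case: (bump_rV_derive C c z k' p' y l) => _ ->.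
split; first exact: bump_rV_continuous.
by move=> x j; case: (bump_rV_derive C c z k' p' x j).
Qed.
End bump_rV.

(** The product of the bumps with [k = 0] and [p = 1] is at most 1 on its support and
    bounded below on the ball of half radius, so its integral is finite and
    positive and it can be normalised. *)
Lemma bump_density (R : realType) N (z : 'rV[R]_N) (rho : R) : 0 < rho ->
  exists (nu : 'rV[R]_N -> R) (M : R), [/\ 0 < M, smooth nu, probability_density nu,
    forall y, nu y <= M & forall y, nu y != 0 -> `|y - z| < rho].
Proof.
move=> rho0; pose phi C := bump_rV C rho^-1 z (fun=> 0%N) (fun=> 1).
have bumpE s : bump 0 1 s = if `|s| < 1 then expR (- (1 - s ^+ 2)^-1) else 0 :> R.
  by rewrite /bump /bump_core expr0 mul1r hornerE mul1r.
have b01 (s : R) : 0 <= bump 0 1 s <= 1.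
  rewrite bumpE; case: ifPn => s1; last by rewrite lexx ler01.
  rewrite expR_ge0/= -[leRHS]expR0 ler_expR oppr_le0 invr_ge0 ltW//.
  exact: one_minus_sqr_gt0.
have phiC C y : phi C y = C * phi 1 y by rewrite /phi /bump_rV mul1r.
have phi0 y : 0 <= phi 1 y.
  by rewrite /phi /bump_rV mul1r prodr_ge0// => j _; case/andP: (b01 (rho^-1 * (y 0 j - z 0 j))).
have phi1 y : phi 1 y <= 1.
  rewrite /phi /bump_rV mul1r; apply: prodr_ile1 => j _; exact: b01.
have cphi C : continuous (phi C) by exact: bump_rV_continuous.
have mphi C : measurable_fun setT (EFin \o phi C).
  by apply/measurable_EFinP; exact: rV_continuous_measurable.
have supp y : phi 1 y != 0 -> `|y - z| < rho.
  move=> py; apply/(rV_norm_lt _ rho0) => j; rewrite ltNge; apply/negP => yz.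
  move/negP: py; apply; rewrite /phi /bump_rV (bigD1 j)//= [bump _ _ _]bumpE ifF ?mul0r ?mulr0//.
  apply/negbTE; rewrite -leNgt normrM gtr0_norm ?invr_gt0// ler_pdivlMl// mulr1.
  by move: yz; rewrite !mxE.
pose I := (\int[lebesgue_rV R N]_y (phi 1 y)%:E)%E.
have indic_int (r : R) (D : set 'rV[R]_N) : 0 <= r -> measurable D ->
   (\int[lebesgue_rV R N]_y (r%:E * (\1_D y)%:E) = r%:E * lebesgue_rV R N D)%E.
  move=> r0 mD; rewrite ge0_integralZl//.
  - by rewrite integral_indic// setIT.
  - by apply/measurable_EFinP; exact: measurable_indic.
have Ile : (I <= lebesgue_rV R N (ball z rho))%E.
  rewrite -[leRHS]mul1e -indic_int//; last exact: measurable_rV_ball.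
  apply: le_integral_ge0 => // y _; first by rewrite lee_fin.
  rewrite mul1e lee_fin indicE.
  have [_|yB] := boolP (y \in _); first exact: phi1.
  rewrite leNgt; apply/negP => py; move/negP: yB; apply; rewrite inE.
  by apply/mem_ballP; rewrite distrC; apply: supp; rewrite gt_eqF.
pose m : R := expR (- (4 / 3)).
have m0 : 0 < m by exact: expR_gt0.
have Ige : ((m ^+ N)%:E * lebesgue_rV R N (ball z (rho / 2)) <= I)%E.
  rewrite -indic_int ?exprn_ge0 ?(ltW m0)//; last exact: measurable_rV_ball.
  apply: le_integral_ge0 => //.
  - by move=> y _; rewrite mule_ge0 ?lee_fin// exprn_ge0// ltW.
  - by move=> y _; rewrite lee_fin.
  move=> y _; rewrite indicE; have [/set_mem/mem_ballP yz|_] := boolP (y \in _); last first.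
    by rewrite mule0 lee_fin.
  rewrite mule1 lee_fin /phi /bump_rV mul1r -[X in _ ^+ X]card_ord -prodr_const.
  apply: ler_prod => j _; rewrite (ltW m0)/= bumpE.
  have s12 : `|rho^-1 * (y 0 j - z 0 j)| <= 2^-1.
    rewrite normrM gtr0_norm ?invr_gt0// ler_pdivrMl// distrC.
    have := rV_coord_le (z - y) j; rewrite !mxE => /le_trans; apply.
    exact: ltW.
  rewrite (le_lt_trans s12) ?invf_lt1 ?ltr1n// ler_expR lerN2.
  set s := rho^-1 * _ in s12 *.
  have s2 : s ^+ 2 <= 1 / 4.
    rewrite -real_normK ?num_real// expr2.
    apply: le_trans (ler_pM _ _ s12 s12) _ => //; lra.
  rewrite -[leRHS]invrK lef_pV2 ?posrE; lra.
have I0 : (0 < I)%E.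
  apply: lt_le_trans Ige; rewrite lebesgue_rV_ball ?divr_gt0// -EFinM lte_fin.
  by rewrite mulr_gt0 ?exprn_gt0// mulrn_wgt0// divr_gt0.
have Ifin : (I < +oo)%E by apply: le_lt_trans Ile _; rewrite lebesgue_rV_ball ?ltry.
have [r rI] : exists r, I = r%:E.
  by exists (fine I); rewrite fineK// ge0_fin_numE// ltW.
have r0 : 0 < r by rewrite -lte_fin -rI.
exists (phi r^-1), r^-1; split.
- by rewrite invr_gt0.
- exact: bump_rV_smooth.
- split=> [y|]; first by rewrite phiC mulr_ge0// invr_ge0 ltW.
  rewrite (eq_integral (fun y => (r^-1)%:E * (phi 1 y)%:E)%E) => [|y _]; last first.
    by rewrite phiC EFinM.
  rewrite ge0_integralZl//; first by rewrite -/I rI -EFinM mulVf ?gt_eqF.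
  + exact: mphi.
  + by move=> y _; rewrite lee_fin.
  + by rewrite lee_fin invr_ge0 ltW.
- by move=> y; rewrite phiC ler_piMr// invr_ge0 ltW.
- by move=> y; rewrite phiC mulf_eq0 negb_or => /andP[_]; exact: supp.
Qed.

(** * The Doeblin lower bound *)

Lemma euclidean_norm_lt (R : realType) N (x z : 'rV[R]_N) (r : R) : 0 < r ->
  euclidean_ball z r x -> `|x - z| < r.
Proof.
move=> r0 xz; apply/(rV_norm_lt _ r0) => j; apply: le_lt_trans xz.
rewrite -sqrtr_sqr ler_wsqrtr// (bigD1 j)//= !mxE lerDl sumr_ge0// => k _.
exact: sqr_ge0.
Qed.

Lemma norm_euclidean_ball (R : realType) N (x z : 'rV[R]_N) (r : R) : 0 < r ->
  `|x - z| <= r -> euclidean_ball z (Num.sqrt (N%:R * r ^+ 2) + 1) x.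
Proof.
move=> r0 xz; rewrite /euclidean_ball /=.
apply: le_lt_trans (_ : Num.sqrt (N%:R * r ^+ 2) < _); last by rewrite ltrDl.
apply: ler_wsqrtr; rewrite mulr_natl -[X in _ *+ X]card_ord -sumr_const.
apply: ler_sum => j _; rewrite -real_normK ?num_real// lerXn2r ?nnegrE ?(ltW r0)//.
by have := rV_coord_le (x - z) j; rewrite !mxE => /le_trans; exact.
Qed.

Theorem theorem6 (R : realType) (N : nat) (hN : (0 < N)%N)
    (b : 'rV[R]_N -> 'rV[R]_N) (a : 'I_N -> 'rV[R]_N -> 'rV[R]_N)
    (f : 'I_N -> 'rV[R]_N -> R) (gamma : R -> 'rV[R]_N -> 'rV[R]_N)
    (hb : C1 b) (ha : forall i, C1 (a i)) (hgamma : is_flow b gamma)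
    (d : measure_display) (Omega : measurableType d) (P : probability Omega R)
    (M : 'I_N -> Omega -> {measure set (R * R) -> \bar R})
    (hM : independent_prms P M)
    (X : 'rV[R]_N -> R -> Omega -> 'rV[R]_N)
    (hX : unique_solutions b a f P M X)
    (m : probability 'rV[R]_N R)
    (hA1 : A1 b a f) (hA2 : A2 f gamma) (hA3 : A3 f P X m)
    (n : nat) (hn : (0 < n)%N) (i : 'I_n.+1 -> 'I_N)
    (hdet : 0 < inf (range (fun x0 : 'rV[R]_N =>
       \det (derivation_matrix a gamma i x0 0
             *m (derivation_matrix a gamma i x0 0)^T)))) :
  forall z0 : 'rV[R]_N,
  exists (zn : 'rV[R]_N) (delta1 delta2 beta : R) (nu : 'rV[R]_N -> R),
    [/\ 0 < delta1, 0 < delta2, 0 < beta < 1,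
        [/\ smooth nu, probability_density nu,
            compact (support_closure nu) &
            support_closure nu `<=` euclidean_ball zn delta2] &
        forall (x : 'rV[R]_N) (A : set 'rV[R]_N), measurable A ->
          ((beta * \1_(euclidean_ball z0 delta1) x)%:E
             * \int[lebesgue_rV R N]_(y in A) (nu y)%:E
           <= jump_kernel_iter a f gamma n.+1 x A)%E].
Proof.
have [_ lipf f0 lipb _] := hA1.
have ca j : continuous (a j).
  by move=> x; apply: differentiable_continuous; have [] := ha j.
have cf j : continuous (f j) by exact: lipschitz_continuous.
move=> z0; set y := jump a (i ord0) z0.
have rD : \rank (derivation_matrix a gamma i y 0)^T = N.
  by apply: det_mulmx_tr_neq0; rewrite gt_eqF// (inf_range_gt0 y hdet).
have GD := strict_derivative_final_state hgamma lipb ha i y.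
have [c [e [d1 [c0 e0 d10 Kge]]]] := jump_kernel_iter_ge hgamma lipb ca cf f0 i z0.
have [zn [kappa [rho [d2 [kappa0 rho0 d20 minor]]]]] :=
  strict_derivative_minorization GD rD (final_state_measurable hgamma lipb ca i) e0.
have [d3 d30 near_y] := continuous_dist_lt z0 (jump_continuous ca (i := i ord0)) d20.
have [nu [B [B0 snu dnu nuB supp]]] := bump_density zn rho0.
have bigsupp : support_closure nu `<=` closed_ball_ (fun v : 'rV[R]_N => `|v|) zn rho.
  apply: subset_trans (@closed_closed_ball_ _ _ zn rho); apply: closureS => x /supp.
  by rewrite /closed_ball_ /= distrC => /ltW.
exists zn, (Num.min d1 d3), (Num.sqrt (N%:R * rho ^+ 2) + 1),
  (Num.min (c * kappa / B) 2^-1), nu.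
split.
- by rewrite lt_min d10.
- by rewrite ltr_wpDl// sqrtr_ge0.
- by rewrite lt_min divr_gt0 ?mulr_gt0//= invr_gt0 ltr0n gt_min invf_lt1 ?ltr1n// orbT.
- split=> //.
  + apply: bounded_closed_compact; last exact: closed_closure.
    exists (`|zn| + rho); split=> [|r rr v /bigsupp]; first exact: num_real.
    rewrite /closed_ball_ /= distrC => vz; rewrite -(subrK zn v).
    by rewrite (le_trans (ler_normD _ _))// addrC (le_trans _ (ltW rr))// lerD2l.
  + move=> x /bigsupp; rewrite /closed_ball_ /= distrC; exact: norm_euclidean_ball.
move=> x A mA.
have K0 : (0 <= jump_kernel_iter a f gamma n.+1 x A)%E.
  exact: jump_kernel_iter_ge0.
rewrite indicE; have [/set_mem xz|_] := boolP (x \in _); last by rewrite mulr0 mul0e.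
rewrite mulr1.
have := euclidean_norm_lt _ xz; rewrite lt_min d10 d30 => /(_ isT).
rewrite lt_min => /andP[x1 x3].
pose S := A `&` ball zn rho.
have mS : measurable S by apply: measurableI => //; exact: measurable_rV_ball.
have nuS : (\int[lebesgue_rV R N]_(y in A) (nu y)%:E <= B%:E * lebesgue_rV R N S)%E.
  apply: (@le_trans _ _ (\int[lebesgue_rV R N]_y (B%:E * (\1_S y)%:E))%E).
    apply: le_integral_ge0 => // [v _|v _|v Av].
    - by rewrite lee_fin; exact: dnu.1.
    - by rewrite mule_ge0// lee_fin ltW.
    rewrite indicE; have [vS|vS] := boolP (v \in S); first by rewrite mule1 lee_fin.
    rewrite mule0 lee_fin leNgt; apply/negP => v0; move/negP: vS; apply.
    rewrite inE; split=> //; apply/mem_ballP; rewrite distrC; apply: supp.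
    by rewrite gt_eqF.
  rewrite ge0_integralZl//.
  - by rewrite integral_indic// setIT.
  - by apply/measurable_EFinP; exact: measurable_indic.
  - by rewrite lee_fin ltW.
apply: le_trans (lee_wpmul2l _ nuS) _.
  by rewrite lee_fin le_min !divr_ge0 ?mulr_ge0 ?ltW.
apply: (@le_trans _ _ (c%:E * (kappa%:E * lebesgue_rV R N S))%E).
  rewrite !muleA -!EFinM; apply: lee_wpmul2r => //; rewrite lee_fin.
  by rewrite -ler_pdivlMr// ge_min lexx.
apply: le_trans (Kge x A x1 mA); rewrite lee_pmul2l//.
apply: le_trans (minor _ S (near_y x x3) mS _) _; first by move=> v [].
have mshort := short_times_measurable hgamma lipb ca i x e.
have sub D : [set t : 'rV[R]_n.+1 | (forall j, 0 <= t 0%R j <= e) /\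
    D (final_state a gamma i (jump a (i ord0) x) t)] = short_times a gamma i x e D.
  by apply/seteqP; split=> t [te Dt]; split=> //; move: Dt; rewrite jump_flow_final_state.
rewrite sub; apply: le_measure; rewrite ?inE; [exact: mshort|exact: mshort|].
by move=> t [te [At _]].
Qed.
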